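(* Let $\tau>0$. Let $u:\mathbb R\times(0,\tau)\to\mathbb R$ be twice continuously differentiable in $x$ and continuously differentiable in $t$, with $\partial_tu-\partial_x^2u=0$ on $\mathbb R\times(0,\tau)$. Suppose that for each $0<\sigma<\tau$: $u(\cdot,t)\in\mathcal A_{c,\sigma}$ and the quantity $\|u(\cdot,t)\|_\sigma\sqrt{\tau-\sigma-t}$ is bounded for all $0<t<\tau-\sigma$, and $\lim_{t\to0^+}\|u(\cdot,t)-f\|_\sigma=0$, for some $f\in\mathcal A_{c,\tau}$. Then $u(x,t)=f\ast\Theta_t(x)$ for all $(x,t)\in\mathbb R\times(0,\tau)$; i.e., $f\ast\Theta_t$ is the unique solution with these properties.
   Context: Let $\mathcal B_c$ be the set of continuous $G:\mathbb R\to\mathbb R$ with real limits at $\pm\infty$ and $\lim_{x\to-\infty}G(x)=0$, and $\mathcal A_c$ the distributions $G'$ ($G\in\mathcal B_c$) with integral $\int_a^bG'=G(b)-G(a)$ and Alexiewicz norm $\|G'\|=\sup_{x<y}|G(y)-G(x)|$; for $h$ of bounded variation, $\int_{-\infty}^\infty G'h:=G(\infty)h(\infty)-\int G\,dh$ (Henstock–Stieltjes). For $\sigma>0$ let $\omega_\sigma(x)=e^{-x^2/(4\sigma)}$. The weighted space $\mathcal A_{c,\sigma}$ is the set of distributions $f$ on $\mathbb R$ such that $f\omega_\sigma\in\mathcal A_c$, normed by $\|f\|_\sigma=\|f\omega_\sigma\|$ (in the paper this space is defined through primitives solving a Volterra equation, and this characterization is proved equivalent); $\mathcal A_{c,\tau}\subset\mathcal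 A_{c,\sigma}$ for $\sigma<\tau$. For $f\in\mathcal A_{c,\tau}$ and $0<t<\tau$, $f\ast\Theta_t(x)=\int_{-\infty}^\infty(f\omega_\tau)(\xi)\,\frac{\Theta_t(x-\xi)}{\omega_\tau(\xi)}\,d\xi$ (an $\mathcal A_c$ integral against a bounded-variation function), where $\Theta_t(x)=(4\pi t)^{-1/2}e^{-x^2/(4t)}$. *)

(* Defs.v *)
From Stdlib Require Import Reals.
From Coquelicot Require Import Coquelicot.
Open Scope R_scope.

Definition omega (s x : R) : R := exp (- (x ^ 2) / (4 * s)).

Definition Theta (t x : R) : R := / sqrt (4 * PI * t) * exp (- (x ^ 2) / (4 * t)).

Definition Rint_line (g : R -> R) : R :=
  RInt_gen g (Rbar_locally m_infty) (Rbar_locally p_infty).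

Definition Bc (G : R -> R) : Prop :=
  (forall x, continuous G x) /\
  (exists l : R, is_lim G p_infty l) /\
  is_lim G m_infty 0.

Definition test_fun (phi : R -> R) : Prop :=
  (forall (n : nat) (x : R), ex_derive_n phi n x) /\
  (exists a b : R, forall x, (x < a \/ b < x) -> phi x = 0).

(* A distribution is represented by its action on test functions. *)
Definition distr := (R -> R) -> R.

Definition fun_distr (g : R -> R) : distr := fun phi => Rint_line (fun x => g x * phi x).

Definition distr_sub (S T : distr) : distr := fun phi => S phi - T phi.

(* G is the primitive (in B_c) of the distribution S * omega_sigma, i.e.
   S * omega_sigma = G' in the sense of distributions.  Hence
   S \in A_{c,sigma} iff such a G exists (G is then unique). *)
Definition Acs_prim (s : R) (S : distr) (G : R -> R) : Prop :=
  Bc G /\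
  forall phi, test_fun phi ->
    S (fun x => omega s x * phi x) = - Rint_line (fun x => G x * Derive phi x).

(* Alexiewicz norm of G' : sup_{x<y} |G(y) - G(x)|. *)
Definition alex_norm (G : R -> R) : R :=
  real (Lub_Rbar (fun r => exists x y, x < y /\ r = Rabs (G y - G x))).

(* f * Theta_t (x) for f in A_{c,tau} with f omega_tau = G',  0 < t < tau:
   int (f omega_tau)(xi) h(xi) dxi := G(oo) h(oo) - int G dh,
   with h(xi) = Theta_t(x - xi) / omega_tau(xi); since h is C^1 with
   integrable derivative, int G dh = int G h'. *)
Definition heat_conv (tau : R) (G : R -> R) (t x : R) : R :=
  let h := fun xi => Theta t (x - xi) / omega tau xi in
  real (Lim G p_infty) * real (Lim h p_infty)
  - Rint_line (fun xi => G xi * Derive h xi).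

(* Main.v *)
Require Import Defs.
From Stdlib Require Import Reals Lra Psatz FunctionalExtensionality.
From Coquelicot Require Import Coquelicot.
Open Scope R_scope.

(** For fixed [(x, t)] and [s < t], let [I_r s] be the integral over [[-r, r]] of [u y s]
    against the backward heat kernel [Theta (t - s) (x - y)] times the cutoff
    [(1 - (y / r) ^ 2) ^ 3].  As [u] and the kernel solve adjoint heat equations, by Green's
    formula [I_r'] only involves derivatives of the cutoff; integrating by parts once more,
    onto the bounded primitive of [u(., s) * omega sigma] with [t - s < sigma < tau - s],
    makes [I_r'] of size [O(1 / r)].  Such a [sigma] serves for all [s] in an interval of
    length less than [tau - t], and finitely many of these cover [(0, t)].  As [s] tends to
    [0] the hypothesis on the initial values turns [I_r s] into a truncation of
    [heat_conv tau G t x]; as [s] tends to [t] the kernel concentrates at [x] and gives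
    [u x t]. *)

(** * Calculus and the Gaussian integral *)

(** Away from [(x, t)] there is no pointwise control of [u] or its derivatives, only a bound on the
    primitive of [u(., s) * omega sigma]. Hence the integrals of [u] stay on [[- r, r]], where
    differentiating under the integral is harmless, and the remainders are integrated by parts onto
    that primitive. The constraints on [sigma] have opposite sources: [t - s < sigma] makes
    [Theta (t - s) (x - y) / omega sigma y] decay in [y], while [sigma < tau - s] keeps [s] in the
    range where the norm is bounded.

    The cutoff is a polynomial, so the cut kernel is no test function, whereas the initial
    distribution is known through test functions only. The du Bois-Reymond lemma bridges the gap: it
    turns the distributional identity for [u(., s) - f] into a pointwise one between primitives,
    which can be paired with any C^1 kernel vanishing at both ends.

    The order of limits matters: for fixed [r] the starting time goes to 0, the terminal time [b] is
    chosen near [t] before [r], and [r] goes to infinity last. So the constants of the [O(1 / r)]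
    bounds may depend on [b], but neither on [r] nor on the starting time that tends to 0. *)

Section Continuity.
Context {U : UniformSpace}.
Implicit Types (f g : U -> R) (x : U).

Lemma cont_plus f g x :
  continuous f x -> continuous g x -> continuous (fun y => f y + g y) x.
Proof. apply (continuous_plus (V := R_NormedModule) f g x). Qed.

Lemma cont_opp f x : continuous f x -> continuous (fun y => - f y) x.
Proof. apply (continuous_opp (V := R_NormedModule) f x). Qed.

Lemma cont_minus f g x :
  continuous f x -> continuous g x -> continuous (fun y => f y - g y) x.
Proof. apply (continuous_minus (V := R_NormedModule) f g x). Qed.

Lemma cont_mult f g x :
  continuous f x -> continuous g x -> continuous (fun y => f y * g y) x.
Proof. apply (continuous_mult (K := R_AbsRing) f g x). Qed.

Lemma cont_comp f (h : R -> R) x :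
  continuity_pt h (f x) -> continuous f x -> continuous (fun y => h (f y)) x.
Proof.
intros Hh Hf. apply (continuous_comp f h x Hf).
now apply continuity_pt_filterlim.
Qed.

Lemma cont_exp f x : continuous f x -> continuous (fun y => exp (f y)) x.
Proof. apply (cont_comp f exp x), derivable_continuous_pt, derivable_pt_exp. Qed.

Lemma cont_sqrt f x : 0 <= f x -> continuous f x -> continuous (fun y => sqrt (f y)) x.
Proof. intros H; apply (cont_comp f sqrt x), continuity_pt_sqrt, H. Qed.

Lemma cont_inv f x : f x <> 0 -> continuous f x -> continuous (fun y => / f y) x.
Proof.
intros H; apply (cont_comp f Rinv x).
apply (continuity_pt_inv id); [apply derivable_continuous_pt, derivable_pt_id | exact H].
Qed.

Lemma cont_div f g x :
  g x <> 0 -> continuous f x -> continuous g x -> continuous (fun y => f y / g y) x.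
Proof. intros H Hf Hg; apply cont_mult; [exact Hf | now apply cont_inv]. Qed.

Lemma cont_pow f n x : continuous f x -> continuous (fun y => f y ^ n) x.
Proof.
intros H; apply (cont_comp f (fun y => y ^ n) x); [|exact H].
apply derivable_continuous_pt, derivable_pt_pow.
Qed.
End Continuity.

(** Follows the syntax of the function; what it leaves are nonvanishing denominators, signs under
    roots and the continuity of opaque atoms. *)
Ltac cont :=
  repeat (try assumption;
    lazymatch goal with
    | |- continuous (fun _ => ?c) _ => apply continuous_const
    | |- continuous (fun y => y) _ => apply continuous_id
    | |- continuous (fun y => fst y) _ => apply continuous_fst
    | |- continuous (fun y => snd y) _ => apply continuous_snd
    | |- continuous (fun y => @?f y + @?g y) _ => apply (cont_plus f g)
    | |- continuous (fun y => @?f y - @?g y) _ => apply (cont_minus f g)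
    | |- continuous (fun y => - @?f y) _ => apply (cont_opp f)
    | |- continuous (fun y => exp (@?f y)) _ => apply (cont_exp f)
    | |- continuous (fun y => sqrt (@?f y)) _ => apply (cont_sqrt f)
    | |- continuous (fun y => @?f y / @?g y) _ => apply (cont_div f g)
    | |- continuous (fun y => / @?f y) _ => apply (cont_inv f)
    | |- continuous (fun y => @?f y ^ ?n) _ => apply (cont_pow f n)
    | |- continuous (fun y => @?f y * @?g y) _ => apply (cont_mult f g)
    end).

Lemma ex_RInt_cont (f : R -> R) a b : (forall x, continuous f x) -> ex_RInt f a b.
Proof. intros H; apply (ex_RInt_continuous (V := R_CompleteNormedModule) f a b); intros; apply H. Qed.

Lemma RInt_ftc (f df : R -> R) a b :
  (forall x, Rmin a b <= x <= Rmax a b -> is_derive f x (df x)) ->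
  (forall x, Rmin a b <= x <= Rmax a b -> continuous df x) ->
  RInt df a b = f b - f a.
Proof. intros H1 H2. exact (is_RInt_unique _ _ _ _ (is_RInt_derive f df a b H1 H2)). Qed.

Lemma is_derive_prim (f : R -> R) x :
  (forall y, continuous f y) -> is_derive (fun r => RInt f 0 r) x (f x).
Proof.
intros H. apply (is_derive_RInt (V := R_NormedModule) f (fun r => RInt f 0 r) 0 x); [|apply H].
apply filter_forall; intros r.
exact (RInt_correct (V := R_CompleteNormedModule) f 0 r (ex_RInt_cont f 0 r H)).
Qed.

(* Equalities on the carriers of Coquelicot's structures on R, restated in R. *)
Ltac real_eq := match goal with |- @eq _ ?a ?b => refine (_ : @eq R a b) end.
Ltac toR :=
  unfold plus, minus, opp, scal, zero; simpl; unfold plus, mult, opp; simpl; real_eq.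

Lemma is_derive_eq (f : R -> R) x l l' : is_derive f x l -> l = l' -> is_derive f x l'.
Proof. now intros H <-. Qed.

Lemma is_derive_0_const (f : R -> R) :
  (forall x, is_derive f x 0) -> forall a b, f a = f b.
Proof.
intros H a b.
destruct (MVT_gen f a b (fun _ => 0)) as [c [_ Hc]].
- intros; apply H.
- intros c _. apply continuity_pt_filterlim, (ex_derive_continuous f c). eexists; apply H.
- lra.
Qed.

Definition gauss_half (r : R) : R := RInt (fun z => exp (- z ^ 2)) 0 r.
(** The companion in the classical evaluation of the Gaussian integral by differentiation under the
    integral sign: its derivative cancels that of [gauss_half r ^ 2], and at [r = 0] it is an
    arctangent integral. *)
Definition gauss_aux (r : R) : R :=
  RInt (fun z => exp (- (r ^ 2 * (1 + z ^ 2))) / (1 + z ^ 2)) 0 1.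

Lemma is_derive_gauss_half r : is_derive gauss_half r (exp (- r ^ 2)).
Proof. apply (is_derive_prim (fun z => exp (- z ^ 2))); intros; cont. Qed.

Lemma is_derive_gauss_aux r :
  is_derive gauss_aux r (- 2 * exp (- r ^ 2) * gauss_half r).
Proof.
assert (D : forall s z, is_derive (fun r => exp (- (r ^ 2 * (1 + z ^ 2))) / (1 + z ^ 2)) s
   (- 2 * s * exp (- (s ^ 2 * (1 + z ^ 2))))).
{ intros s z. auto_derive. nra. simpl. field. nra. }
assert (E : RInt (fun z => Derive (fun r => exp (- (r ^ 2 * (1 + z ^ 2))) / (1 + z ^ 2)) r) 0 1
  = - 2 * exp (- r ^ 2) * gauss_half r).
{ set (k := - 2 * exp (- r ^ 2)).
  (* The exponential factors as [exp (- r ^ 2) * exp (- (r * z) ^ 2)], and the substitution [r * z]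
     turns the second factor into [gauss_half]. *)
  rewrite (RInt_ext _ (fun z => k * r * exp (- (r * z) ^ 2))).
  2: { intros z _. etransitivity; [apply is_derive_unique, D |]. unfold k.
       replace (- (r ^ 2 * (1 + z ^ 2))) with (- r ^ 2 + - (r * z) ^ 2) by ring.
       rewrite exp_plus. toR; ring. }
  rewrite (RInt_ftc (fun z => k * gauss_half (r * z))).
  - rewrite Rmult_1_r, Rmult_0_r. unfold gauss_half at 2. rewrite RInt_point.
    toR; ring.
  - intros z _.
    assert (Dz : is_derive (fun z => r * z) z r) by (auto_derive; trivial; ring).
    eapply is_derive_eq.
    + exact (is_derive_scal (fun z => gauss_half (r * z)) z k _
        (is_derive_comp gauss_half (fun z => r * z) z _ _ (is_derive_gauss_half (r * z)) Dz)).
    + toR; ring.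
  - intros z _. cont. }
rewrite <- E.
apply (is_derive_RInt_param (fun r z => exp (- (r ^ 2 * (1 + z ^ 2))) / (1 + z ^ 2)) 0 1 r).
- apply filter_forall; intros s z _. eexists; apply D.
- intros z _.
  apply (continuity_2d_pt_ext (fun r z => - 2 * r * exp (- (r ^ 2 * (1 + z ^ 2))))).
  + intros a b. symmetry. apply is_derive_unique, D.
  + apply continuity_2d_pt_filterlim. change (continuous (fun p : R * R => - 2 * fst p * exp (- (fst p ^ 2 * (1 + snd p ^ 2)))) (r, z)). cont.
- apply filter_forall; intros s. apply ex_RInt_cont; intros y. cont. nra.
Qed.

Lemma gauss_half_sq r : gauss_half r ^ 2 + gauss_aux r = PI / 4.
Proof.
rewrite (is_derive_0_const (fun r => gauss_half r ^ 2 + gauss_aux r)) with (b := 0).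
- unfold gauss_half at 1. rewrite RInt_point. unfold gauss_aux.
  rewrite (RInt_ext _ (fun z => / (1 + z ^ 2))).
  2: { intros z _. replace (- (0 ^ 2 * (1 + z ^ 2))) with 0 by ring. rewrite exp_0. apply Rmult_1_l. }
  rewrite (RInt_ftc atan).
  + rewrite atan_1, atan_0. unfold zero; simpl. field.
  + intros z _. generalize (is_derive_atan z). now replace (/ (1 + z²)) with (/ (1 + z ^ 2)) by (unfold Rsqr; f_equal; ring).
  + intros z _. cont. nra.
- intros x.
  eapply is_derive_eq. apply (is_derive_plus (V := R_NormedModule)).
  apply (is_derive_pow gauss_half 2 x), is_derive_gauss_half.
  apply is_derive_gauss_aux. toR; ring.
Qed.

Lemma is_lim_gauss_half : is_lim gauss_half p_infty (sqrt PI / 2).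
Proof.
(* [gauss_aux] dies at infinity because [exp (- X) <= / X] with [X >= r]; the limit of the square is
   then [PI / 4], and the sign of [gauss_half] selects the root. *)
assert (A : forall r, 1 < r -> 0 <= gauss_aux r <= / r).
{ intros r Hr. 
  assert (B : forall z, 0 <= exp (- (r ^ 2 * (1 + z ^ 2))) / (1 + z ^ 2) <= / r).
  { intros z. assert (H1 := exp_pos (- (r ^ 2 * (1 + z ^ 2)))).
    assert (H2 : 0 < / (1 + z ^ 2) <= 1).
    { split. apply Rinv_0_lt_compat; nra. rewrite <- Rinv_1. apply Rinv_le_contravar; nra. }
    assert (H3 : exp (- (r ^ 2 * (1 + z ^ 2))) <= / r).
    { rewrite exp_Ropp. apply Rinv_le_contravar; [lra|].
      assert (H4 := exp_ineq1_le (r ^ 2 * (1 + z ^ 2))). nra. }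
    unfold Rdiv; split; nra. }
  assert (I : ex_RInt (fun z => exp (- (r ^ 2 * (1 + z ^ 2))) / (1 + z ^ 2)) 0 1)
    by (apply ex_RInt_cont; intros; cont; nra).
  unfold gauss_aux; split.
  - apply RInt_ge_0; [lra | exact I | intros; apply B].
  - replace (/ r) with (RInt (fun _ => / r) 0 1)
      by (rewrite RInt_const; unfold scal; simpl; unfold mult; simpl; ring).
    apply RInt_le; [lra | exact I | apply ex_RInt_const | intros; apply B]. }
assert (P := PI_RGT_0).
assert (N : forall r, 0 <= r -> 0 <= gauss_half r).
{ intros r Hr; apply RInt_ge_0; [exact Hr | apply ex_RInt_cont; intros; cont |].
  intros; left; apply exp_pos. }
apply (is_lim_ext_loc (fun r => sqrt (PI / 4 - gauss_aux r))).
{ exists 1. intros r Hr. rewrite <- (gauss_half_sq r).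
  replace (gauss_half r ^ 2 + gauss_aux r - gauss_aux r) with (gauss_half r ^ 2) by ring.
  apply sqrt_pow2, N. lra. }
replace (sqrt PI / 2) with (sqrt (PI / 4)).
2: { rewrite sqrt_div by lra. f_equal. replace 4 with (2 ^ 2) by ring. apply sqrt_pow2; lra. }
apply (is_lim_comp_continuous (fun r => PI / 4 - gauss_aux r) sqrt p_infty (PI / 4)).
- cut (is_lim (fun r => PI / 4 - gauss_aux r) p_infty (PI / 4 - 0)); [now rewrite Rminus_0_r |].
  apply (is_lim_minus' (fun _ => PI / 4) gauss_aux); [apply is_lim_const |].
  apply (is_lim_le_le_loc (fun _ => 0) Rinv).
  + exists 1. exact A.
  + apply is_lim_const.
  + apply (is_lim_inv (fun x => x) p_infty p_infty (is_lim_id p_infty)); discriminate.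
- apply continuity_pt_filterlim, continuity_pt_sqrt. lra.
Qed.

(** * Bump functions and the du Bois-Reymond lemma *)

Lemma Rint_plus (f g : R -> R) a b : ex_RInt f a b -> ex_RInt g a b ->
  RInt (fun x => f x + g x) a b = RInt f a b + RInt g a b.
Proof. exact (RInt_plus (V := R_CompleteNormedModule) f g a b). Qed.

Lemma Rint_minus (f g : R -> R) a b : ex_RInt f a b -> ex_RInt g a b ->
  RInt (fun x => f x - g x) a b = RInt f a b - RInt g a b.
Proof. exact (RInt_minus (V := R_CompleteNormedModule) f g a b). Qed.

Lemma Rint_scal (f : R -> R) k a b : ex_RInt f a b ->
  RInt (fun x => k * f x) a b = k * RInt f a b.
Proof. exact (RInt_scal (V := R_CompleteNormedModule) f a b k). Qed.

Lemma Rint_Chasles (f : R -> R) a b c : ex_RInt f a b -> ex_RInt f b c ->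
  RInt f a c = RInt f a b + RInt f b c.
Proof. intros H1 H2; symmetry; exact (RInt_Chasles (V := R_CompleteNormedModule) f a b c H1 H2). Qed.

Lemma Rint_0 (f : R -> R) a b :
  (forall x, Rmin a b < x < Rmax a b -> f x = 0) -> RInt f a b = 0.
Proof.
intros H. rewrite (RInt_ext _ (fun _ => 0)) by exact H.
rewrite RInt_const. toR. ring.
Qed.

(** For [m > 0], raising [z / m <= exp (z / m)] to the power [m] gives [C = m ^ m]. *)
Lemma pow_le_exp (m : nat) : exists C, 0 < C /\ forall z, 0 <= z -> z ^ m <= C * exp z.
Proof.
destruct m as [|m].
{ exists 1. split; [lra|]. intros z Hz. simpl. assert (H := exp_ineq1_le z). lra. }
assert (Hm : 0 < INR (S m)) by (apply lt_0_INR; lia).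
exists (INR (S m) ^ S m). split; [now apply pow_lt|]. intros z Hz.
replace z with (INR (S m) * (z / INR (S m))) at 1 by (field; lra).
rewrite Rpow_mult_distr. apply Rmult_le_compat_l; [apply pow_le; lra|].
replace z with (INR (S m) * (z / INR (S m))) at 2 by (field; lra).
replace (exp (INR (S m) * (z / INR (S m)))) with (exp (z / INR (S m)) ^ S m).
- apply pow_incr. split; [apply Rdiv_le_0_compat; lra|].
  assert (H := exp_ineq1_le (z / INR (S m))). lra.
- generalize (z / INR (S m)); intros y. generalize (S m); clear; intros n.
  induction n as [|n IH]; [simpl; now rewrite Rmult_0_l, exp_0|].
  rewrite S_INR, Rmult_plus_distr_r, Rmult_1_l, exp_plus, <- IH. simpl; ring.
Qed.

(** A whole family instead of [exp (- / x)] alone: the derivative of a member is a combination of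
    the next two, so no explicit higher derivative is ever needed. *)
Definition flat (n : nat) (x : R) : R :=
  if Rle_dec x 0 then 0 else (/ x) ^ n * exp (- / x).

Lemma flat_nonpos n x : x <= 0 -> flat n x = 0.
Proof. intros H; unfold flat; now destruct (Rle_dec x 0). Qed.

Lemma flat_pos n x : 0 < x -> flat n x = (/ x) ^ n * exp (- / x).
Proof. intros H; unfold flat; destruct (Rle_dec x 0); [lra | reflexivity]. Qed.

Lemma flat_gt_0 n x : 0 < x -> 0 < flat n x.
Proof.
intros H; rewrite flat_pos by exact H.
apply Rmult_lt_0_compat; [apply pow_lt, Rinv_0_lt_compat, H | apply exp_pos].
Qed.

Lemma is_derive_flat n x : is_derive (flat n) x (- INR n * flat (S n) x + flat (S (S n)) x).
Proof.
destruct (Rtotal_order x 0) as [H | [-> | H]].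
- rewrite !flat_nonpos by lra.
  apply (is_derive_ext_loc (fun _ => 0)).
  + exists (mkposreal (- x) ltac:(lra)). intros y Hy. symmetry; apply flat_nonpos.
    apply Rabs_def2 in Hy. unfold minus, plus, opp in Hy; simpl in Hy. lra.
  + eapply is_derive_eq; [apply is_derive_const | toR; ring].
- rewrite !flat_nonpos by lra.
  destruct (pow_le_exp (n + 2)) as [C [HC HCz]].
  (* With [z = / h], the bound [z ^ (n + 2) <= C * exp z] yields quadratic decay at 0: one power of
     [h] is spent on the difference quotient and the other makes it tend to 0. *)
  assert (B : forall h, Rabs (flat n h) <= C * h ^ 2).
  { intros h. destruct (Rle_dec h 0) as [Hh | Hh].
    - rewrite flat_nonpos by exact Hh. rewrite Rabs_R0. nra.
    - apply Rnot_le_lt in Hh. rewrite Rabs_pos_eq by (left; now apply flat_gt_0).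
      rewrite flat_pos by exact Hh.
      assert (Hi := Rinv_0_lt_compat h Hh).
      specialize (HCz (/ h) (Rlt_le _ _ Hi)). rewrite pow_add in HCz.
      assert (He := exp_pos (/ h)). rewrite exp_Ropp.
      apply Rmult_le_reg_r with (exp (/ h) * / h ^ 2).
      { apply Rmult_lt_0_compat; [exact He | apply Rinv_0_lt_compat; nra]. }
      replace ((/ h) ^ n * / exp (/ h) * (exp (/ h) * / h ^ 2)) with ((/ h) ^ n * (/ h) ^ 2)
        by (field; lra).
      replace (C * h ^ 2 * (exp (/ h) * / h ^ 2)) with (C * exp (/ h)) by (field; lra).
      exact HCz. }
  apply is_derive_Reals. intros eps Heps.
  assert (Hd : 0 < eps / (C + 1)) by (apply Rdiv_lt_0_compat; lra).
  exists (mkposreal _ Hd). intros h Hh0 Hh. simpl in Hh.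
  rewrite Rplus_0_l, (flat_nonpos n 0) by lra.
  replace ((flat n h - 0) / h - (- INR n * 0 + 0)) with (flat n h / h) by (field; exact Hh0).
  rewrite Rabs_div by exact Hh0. specialize (B h).
  assert (Hp := Rabs_pos_lt h Hh0).
  apply Rlt_div_l; [exact Hp|].
  rewrite <- pow2_abs in B.
  apply Rlt_div_r in Hh; [|lra]. nra.
- apply (is_derive_ext_loc (fun y => (/ y) ^ n * exp (- / y))).
  + exists (mkposreal x H). intros y Hy. symmetry; apply flat_pos.
    apply Rabs_def2 in Hy. unfold minus, plus, opp in Hy; simpl in Hy. lra.
  + rewrite !flat_pos by exact H. auto_derive; [lra|].
    destruct n as [|n]; [simpl; field; lra|].
    replace (pred (S n)) with n by reflexivity. rewrite <- !tech_pow_Rmult. field. lra.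
Qed.

(* A class of functions closed under differentiation consists of smooth functions;
   this one contains the bump functions, their primitives and the Gaussians. *)
Inductive smooth : (R -> R) -> Prop :=
| smooth_const c : smooth (fun _ => c)
| smooth_id : smooth (fun x => x)
| smooth_plus f g : smooth f -> smooth g -> smooth (fun x => f x + g x)
| smooth_mult f g : smooth f -> smooth g -> smooth (fun x => f x * g x)
| smooth_exp f : smooth f -> smooth (fun x => exp (f x))
| smooth_flat n f : smooth f -> smooth (fun x => flat n (f x))
| smooth_prim f : smooth f -> smooth (fun x => RInt f 0 x).

Lemma smooth_derive f : smooth f -> exists f', smooth f' /\ forall x, is_derive f x (f' x).
Proof.
induction 1 as [c | | f g _ [f' [Sf Df]] _ [g' [Sg Dg]] | f g Ef [f' [Sf Df]] Eg [g' [Sg Dg]]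
  | f Ef [f' [Sf Df]] | n f Ef [f' [Sf Df]] | f Ef [f' [Sf Df]]].
- exists (fun _ => 0). split; [constructor|]. intros x; apply (is_derive_const (V := R_NormedModule) c).
- exists (fun _ => 1). split; [constructor|]. intros x; apply (is_derive_id (K := R_AbsRing)).
- exists (fun x => f' x + g' x). split; [now constructor|]. intros x.
  apply (is_derive_plus f g); auto.
- exists (fun x => f' x * g x + f x * g' x). split; [repeat (constructor; trivial)|]. intros x.
  apply (is_derive_mult f g); auto. intros; apply Rmult_comm.
- exists (fun x => f' x * exp (f x)). split; [repeat (constructor; trivial)|]. intros x.
  apply (is_derive_comp exp f); [apply is_derive_exp | apply Df].
- exists (fun x => f' x * (- INR n * flat (S n) (f x) + flat (S (S n)) (f x))).
  split; [repeat (constructor; trivial)|]. intros x.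
  apply (is_derive_comp (flat n) f); [apply is_derive_flat | apply Df].
- exists f. split; [exact Ef|]. intros x. apply is_derive_prim.
  intros y. apply (ex_derive_continuous f). eexists; apply Df.
Qed.

Lemma smooth_continuous f x : smooth f -> continuous f x.
Proof.
intros Sf. destruct (smooth_derive f Sf) as [f' [_ Df]].
apply (ex_derive_continuous f). eexists; apply Df.
Qed.

Lemma smooth_Derive f : smooth f -> smooth (Derive f).
Proof.
intros Sf. destruct (smooth_derive f Sf) as [f' [Sf' Df]].
replace (Derive f) with f'; [exact Sf'|].
apply functional_extensionality; intros x. symmetry; apply is_derive_unique, Df.
Qed.

Lemma smooth_is_derive f x : smooth f -> is_derive f x (Derive f x).
Proof.
intros Sf. destruct (smooth_derive f Sf) as [f' [_ Df]].
apply Derive_correct. eexists; apply Df.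
Qed.

Lemma smooth_ex_derive_n f n x : smooth f -> ex_derive_n f n x.
Proof.
intros Sf. destruct n as [|n]; [exact I|]. simpl.
assert (S : smooth (Derive_n f n)) by (induction n; simpl; [exact Sf | now apply smooth_Derive]).
eexists; now apply smooth_is_derive.
Qed.

Lemma RInt_bump_gt_0 (g : R -> R) L c e R0 :
  (forall x, continuous g x) -> 0 < e -> L <= c - e -> c + e <= R0 ->
  (forall x, x <= c - e \/ c + e <= x -> g x = 0) ->
  (forall x, c - e < x < c + e -> 0 < g x) -> 0 < RInt g L R0.
Proof.
intros Cg He HL HR H0 Hp.
rewrite (Rint_Chasles g L (c - e)), (Rint_Chasles g (c - e) (c + e)) by now apply ex_RInt_cont.
rewrite (Rint_0 g L), (Rint_0 g (c + e)).
- rewrite Rplus_0_r, Rplus_0_l. apply RInt_gt_0; [lra | exact Hp | intros; apply Cg].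
- intros x. rewrite Rmin_left by lra. intros Hx; apply H0; lra.
- intros x. rewrite Rmax_right by lra. intros Hx; apply H0; lra.
Qed.

(** The affine arguments use only sums and products, so that the constructors of [smooth] apply as
    they stand. *)
Definition bump (c e x : R) : R := flat 0 (x + (e - c)) * flat 0 ((-1) * x + (c + e)).

Lemma smooth_bump c e : smooth (bump c e).
Proof. unfold bump; repeat constructor. Qed.

Lemma bump_0 c e x : x <= c - e \/ c + e <= x -> bump c e x = 0.
Proof.
intros [H | H]; unfold bump.
- rewrite (flat_nonpos 0 (x + (e - c))) by lra. ring.
- rewrite (flat_nonpos 0 ((-1) * x + (c + e))) by lra. ring.
Qed.

Lemma bump_gt_0 c e x : c - e < x < c + e -> 0 < bump c e x.
Proof. intros H; apply Rmult_lt_0_compat; apply flat_gt_0; lra. Qed.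

Lemma continuous_lt_near (F : R -> R) a m : continuous F a -> F a < m ->
  exists e, 0 < e /\ forall x, a - e <= x <= a + e -> F x < m.
Proof.
intros C H. apply continuity_pt_filterlim in C.
destruct (C (m - F a)) as [e [He Hx]]; [lra|].
exists (e / 2). split; [lra|]. intros x Hax.
destruct (Req_dec x a) as [-> | Hne]; [exact H|].
specialize (Hx x). simpl in Hx. unfold R_dist in Hx.
assert (Rabs (F x - F a) < m - F a).
{ apply Hx. split; [split; [exact Logic.I | auto] | apply Rabs_def1; lra]. }
apply Rabs_def2 in H0. lra.
Qed.

(* Du Bois-Reymond: test against the primitive of a balanced difference of two bumps. *)
Lemma du_bois_reymond (F : R -> R) :
  (forall x, continuous F x) ->
  (forall L R0 phi, L < R0 -> smooth phi ->
     (forall x, x <= L \/ R0 <= x -> phi x = 0) ->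
     RInt (fun x => F x * Derive phi x) L R0 = 0) ->
  forall a b, F a = F b.
Proof.
intros CF H.
assert (K : forall a b, ~ F a < F b).
{ intros a b Hab. set (m := (F a + F b) / 2).
  destruct (continuous_lt_near F a m) as [e1 [He1 H1]]; [apply CF | unfold m; lra |].
  destruct (continuous_lt_near (fun x => - F x) b (- m)) as [e2 [He2 H2]];
    [apply cont_opp, CF | unfold m; lra |].
  set (e := Rmin e1 e2).
  assert (He : 0 < e /\ e <= e1 /\ e <= e2)
    by (unfold e; split; [now apply Rmin_pos | split; [apply Rmin_l | apply Rmin_r]]).
  clearbody e.
  set (L := Rmin a b - e). set (R0 := Rmax a b + e).
  assert (HL : L <= a - e /\ L <= b - e)
    by (unfold L; assert (X := Rmin_l a b); assert (Y := Rmin_r a b); lra).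
  assert (HR : a + e <= R0 /\ b + e <= R0)
    by (unfold R0; assert (X := Rmax_l a b); assert (Y := Rmax_r a b); lra).
  clearbody L R0.
  assert (Cb : forall c x, continuous (bump c e) x) by (intros; apply smooth_continuous, smooth_bump).
  assert (CFb : forall c x, continuous (fun x => F x * bump c e x) x)
    by (intros; apply cont_mult; auto).
  assert (Ckb : forall k c x, continuous (fun x => k * bump c e x) x)
    by (intros; apply cont_mult; [apply continuous_const | auto]).
  assert (Xkb : forall k c u v, ex_RInt (fun x => k * bump c e x) u v)
    by (intros; now apply ex_RInt_cont).
  assert (XkFb : forall k c u v, ex_RInt (fun x => k * (F x * bump c e x)) u v)
    by (intros; apply ex_RInt_cont; intros; apply cont_mult; [apply continuous_const | apply CFb]).
  assert (Xb : forall c u v, ex_RInt (bump c e) u v) by (intros; now apply ex_RInt_cont).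
  assert (XFb : forall c u v, ex_RInt (fun x => F x * bump c e x) u v)
    by (intros; now apply ex_RInt_cont).
  set (Ia := RInt (bump a e) L R0 : R). set (Ib := RInt (bump b e) L R0 : R).
  assert (PIa : 0 < Ia).
  { apply (RInt_bump_gt_0 _ L a e R0); auto; try lra; [apply bump_0 | apply bump_gt_0]. }
  assert (PIb : 0 < Ib).
  { apply (RInt_bump_gt_0 _ L b e R0); auto; try lra; [apply bump_0 | apply bump_gt_0]. }
  assert (J1 : RInt (fun x => F x * bump a e x) L R0 < m * Ia).
  { unfold Ia. rewrite <- Rint_scal by auto. apply Rlt_0_minus. rewrite <- Rint_minus by auto.
    apply (RInt_bump_gt_0 _ L a e R0); try lra.
    - intros x; apply cont_minus; auto.
    - intros x Hx. rewrite bump_0 by exact Hx. ring.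
    - intros x Hx. assert (B := bump_gt_0 a e x Hx).
      assert (F x < m) by (apply H1; lra). nra. }
  assert (J2 : m * Ib < RInt (fun x => F x * bump b e x) L R0).
  { unfold Ib. rewrite <- Rint_scal by auto. apply Rlt_0_minus. rewrite <- Rint_minus by auto.
    apply (RInt_bump_gt_0 _ L b e R0); try lra.
    - intros x; apply cont_minus; auto.
    - intros x Hx. rewrite bump_0 by exact Hx. ring.
    - intros x Hx. assert (B := bump_gt_0 b e x Hx).
      assert (- F x < - m) by (apply H2; lra). nra. }
  (* Zero total mass makes the primitive [phi] vanish beyond both ends. By [J1] and [J2] the pairing
     of [F] with [rho] is less than [Ib * (m * Ia) - Ia * (m * Ib) = 0], a contradiction. *)
  set (rho := fun x => Ib * bump a e x + - Ia * bump b e x).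
  assert (Sr : smooth rho).
  { unfold rho. apply smooth_plus; apply smooth_mult; try apply smooth_bump; apply smooth_const. }
  assert (Cr : forall x, continuous rho x) by (intros; now apply smooth_continuous).
  set (phi := fun x => RInt rho 0 x + - RInt rho 0 L).
  assert (Sp : smooth phi) by (apply smooth_plus; [now apply smooth_prim | apply smooth_const]).
  assert (Ep : forall x, phi x = RInt rho L x).
  { intros x. unfold phi. rewrite (Rint_Chasles rho 0 L x) by now apply ex_RInt_cont. ring. }
  assert (Dp : forall x, Derive phi x = rho x).
  { intros x. apply is_derive_unique. eapply is_derive_eq.
    - apply (is_derive_plus (V := R_NormedModule)).
      apply is_derive_prim, Cr. apply (is_derive_const (V := R_NormedModule)).
    - toR; ring. }
  assert (R_0 : forall x, x <= L \/ R0 <= x -> rho x = 0).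
  { intros x Hx. unfold rho. rewrite !bump_0 by lra. ring. }
  assert (Hphi := H L R0 phi ltac:(lra) Sp).
  rewrite (RInt_ext _ (fun x => Ib * (F x * bump a e x) + - Ia * (F x * bump b e x))) in Hphi.
  2: { intros x _. rewrite Dp. unfold rho. toR. ring. }
  rewrite Rint_plus, !Rint_scal in Hphi;auto.
  assert (Ib * RInt (fun x => F x * bump a e x) L R0 + - Ia * RInt (fun x => F x * bump b e x) L R0 = 0).
  { apply Hphi. intros x [Hx | Hx]; rewrite Ep.
    - apply Rint_0. intros y. rewrite Rmax_left by exact Hx. intros Hy; apply R_0; lra.
    - rewrite (Rint_Chasles rho L R0 x) by now apply ex_RInt_cont.
      rewrite (Rint_0 rho R0 x) by (intros y; rewrite Rmin_left by exact Hx; intros; apply R_0; lra).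
      unfold rho. rewrite Rint_plus, !Rint_scal;auto.
      fold Ia Ib. ring. }
  nra. }
intros a b. destruct (Rtotal_order (F a) (F b)) as [Hl | [He | Hg]];
  [now apply K in Hl | exact He | now apply K in Hg].
Qed.

(** * Primitives of weighted distributions *)

Lemma Rint_line_of_lim (f F : R -> R) (l1 l2 : R) :
  (forall a b, is_RInt f a b (F b - F a)) ->
  is_lim F m_infty l1 -> is_lim F p_infty l2 -> Rint_line f = l2 - l1.
Proof.
intros HF H1 H2. unfold Rint_line. apply is_RInt_gen_unique.
intros P [e HP].
apply is_lim_spec in H1. apply is_lim_spec in H2.
destruct (H1 (pos_div_2 e)) as [A HA]. destruct (H2 (pos_div_2 e)) as [B HB].
apply (Filter_prod _ _ _ (fun a => a < A) (fun b => B < b)).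
- now exists A.
- now exists B.
- intros a b Ha Hb. exists (F b - F a). split; [apply HF|].
  apply HP. change (Rabs (F b - F a - (l2 - l1)) < e).
  specialize (HA a Ha). specialize (HB b Hb). simpl in HA, HB.
  apply Rabs_def2 in HA. apply Rabs_def2 in HB. apply Rabs_def1; lra.
Qed.

Lemma is_RInt_prim (f : R -> R) a b :
  (forall x, continuous f x) -> is_RInt f a b (RInt f 0 b - RInt f 0 a).
Proof.
intros Cf.
assert (E : RInt f a b = RInt f 0 b - RInt f 0 a)
  by (rewrite (Rint_Chasles f 0 a b) by (now apply ex_RInt_cont); lra).
rewrite <- E.
apply (RInt_correct (V := R_CompleteNormedModule)), ex_RInt_cont, Cf.
Qed.

Lemma Rint_line_compact (f : R -> R) L R0 :
  (forall x, continuous f x) -> (forall x, x <= L \/ R0 <= x -> f x = 0) ->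
  Rint_line f = RInt f L R0.
Proof.
intros Cf H0. rewrite (Rint_line_of_lim f (fun x => RInt f 0 x) (RInt f 0 L) (RInt f 0 R0)).
- rewrite (Rint_Chasles f 0 L R0) by now apply ex_RInt_cont. ring.
- intros; now apply is_RInt_prim.
- apply (is_lim_ext_loc (fun _ => RInt f 0 L)); [|apply is_lim_const].
  exists L. intros y Hy. rewrite (Rint_Chasles f 0 y L) by now apply ex_RInt_cont.
  rewrite (Rint_0 f y L); [lra |]. intros x. rewrite Rmax_right by lra. intros; apply H0; lra.
- apply (is_lim_ext_loc (fun _ => RInt f 0 R0)); [|apply is_lim_const].
  exists R0. intros y Hy. rewrite (Rint_Chasles f 0 R0 y) by now apply ex_RInt_cont.
  rewrite (Rint_0 f R0 y); [lra |]. intros x. rewrite Rmin_left by lra. intros; apply H0; lra.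
Qed.

Lemma Bc_bounded G : Bc G -> exists M, forall x, Rabs (G x) <= M.
Proof.
intros [CG [[l Hl] H0]].
apply is_lim_spec in Hl. apply is_lim_spec in H0.
destruct (Hl (mkposreal 1 Rlt_0_1)) as [B HB]. destruct (H0 (mkposreal 1 Rlt_0_1)) as [A HA].
simpl in HA, HB.
destruct (bounded_continuity (V := R_NormedModule) G A B) as [M HM]; [intros; apply CG|].
exists (Rmax M (Rabs l + 1)). intros x.
destruct (Rlt_le_dec x A) as [Hx | Hx].
{ apply Rle_trans with (2 := Rmax_r _ _). specialize (HA x Hx). rewrite Rminus_0_r in HA.
  assert (P := Rabs_pos l). lra. }
destruct (Rlt_le_dec B x) as [Hx' | Hx'].
{ apply Rle_trans with (2 := Rmax_r _ _). specialize (HB x Hx').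
  assert (T := Rabs_triang (G x - l) l). replace (G x - l + l) with (G x) in T by ring. lra. }
apply Rle_trans with (2 := Rmax_l _ _). left. apply (HM x). lra.
Qed.

(** Let the lower point of an increment tend to minus infinity, where [G] vanishes. Boundedness of
    [G] is what makes the supremum finite: [real] would send an infinite one to 0. *)
Lemma Bc_le_alex_norm G x : Bc G -> Rabs (G x) <= alex_norm G.
Proof.
intros BG. destruct (Bc_bounded G BG) as [M HM].
assert (HL : forall y, y < x -> Rabs (G x - G y) <= alex_norm G).
{ intros y Hy. unfold alex_norm.
  set (S := fun r => exists x y, x < y /\ r = Rabs (G y - G x)).
  destruct (Lub_Rbar_correct S) as [HU HLst].
  assert (H1 : Rbar_le (Rabs (G x - G y)) (Lub_Rbar S)) by (apply HU; now exists y, x).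
  assert (H2 : Rbar_le (Lub_Rbar S) (2 * M)).
  { apply HLst. intros r [a [b [_ ->]]]. simpl.
    assert (T := Rabs_triang (G b) (- G a)). rewrite Rabs_Ropp in T.
    assert (Ha := HM a). assert (Hb := HM b). unfold Rminus. lra. }
  destruct (Lub_Rbar S); simpl in *; [exact H1 | contradiction | contradiction]. }
destruct BG as [_ [_ H0]].
apply le_epsilon. intros e He.
apply is_lim_spec in H0. destruct (H0 (mkposreal e He)) as [A HA]. simpl in HA.
set (y := Rmin A x - 1).
assert (HyA : y < A) by (unfold y; assert (H := Rmin_l A x); lra).
assert (Hyx : y < x) by (unfold y; assert (H := Rmin_r A x); lra).
specialize (HA y HyA). specialize (HL y Hyx). rewrite Rminus_0_r in HA.
assert (T := Rabs_triang (G x - G y) (G y)). replace (G x - G y + G y) with (G x) in T by ring. lra.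
Qed.

(** The quotient [omega s / omega tau], which carries a primitive for the weight [tau] over to the
    weight [s]; [y * y] fits the constructors of [smooth]. *)
Definition omega_quot (s tau y : R) : R := exp ((/ (4 * tau) - / (4 * s)) * (y * y)).

Definition omega_quot' (s tau y : R) : R :=
  2 * (/ (4 * tau) - / (4 * s)) * y * omega_quot s tau y.

Lemma omega_quotE s tau y : s <> 0 -> tau <> 0 -> omega s y = omega tau y * omega_quot s tau y.
Proof.
intros Hs Ht. unfold omega, omega_quot. rewrite <- exp_plus. f_equal. field. auto.
Qed.

Lemma smooth_omega_quot s tau : smooth (omega_quot s tau).
Proof. unfold omega_quot. repeat constructor. Qed.

Lemma is_derive_omega_quot s tau y : is_derive (omega_quot s tau) y (omega_quot' s tau y).
Proof. unfold omega_quot', omega_quot. auto_derive; trivial. ring. Qed.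

Lemma continuous_omega_quot s tau y : continuous (omega_quot s tau) y.
Proof. apply smooth_continuous, smooth_omega_quot. Qed.

Lemma continuous_omega_quot' s tau y : continuous (omega_quot' s tau) y.
Proof.
unfold omega_quot'. cont. apply continuous_omega_quot.
Qed.

Lemma smooth_omega s : smooth (omega s).
Proof.
replace (omega s) with (fun x => exp ((- / (4 * s)) * (x * x))); [repeat constructor|].
apply functional_extensionality; intros x. unfold omega. f_equal. unfold Rdiv. ring.
Qed.

Lemma continuous_omega s y : continuous (omega s) y.
Proof. apply smooth_continuous, smooth_omega. Qed.

Lemma smooth_test_fun phi L R0 :
  smooth phi -> (forall x, x <= L \/ R0 <= x -> phi x = 0) -> test_fun phi.
Proof.
intros Sp H0. split.
- intros n x. now apply smooth_ex_derive_n.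
- exists L, R0. intros x Hx; apply H0; lra.
Qed.

Lemma Derive_0_outside phi L R0 x :
  smooth phi -> (forall x, x <= L \/ R0 <= x -> phi x = 0) -> x <= L \/ R0 <= x -> Derive phi x = 0.
Proof.
intros Sp H0.
assert (A : forall x, x < L \/ R0 < x -> Derive phi x = 0).
{ intros y Hy. rewrite (Derive_ext_loc phi (fun _ => 0)); [apply Derive_const|].
  destruct Hy as [Hy | Hy].
  - exists (mkposreal (L - y) ltac:(lra)). intros z Hz. apply Rabs_def2 in Hz.
    unfold minus, plus, opp in Hz; simpl in Hz. apply H0; lra.
  - exists (mkposreal (y - R0) ltac:(lra)). intros z Hz. apply Rabs_def2 in Hz.
    unfold minus, plus, opp in Hz; simpl in Hz. apply H0; lra. }
assert (C : forall x, continuous (Derive phi) x)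
  by (intros; now apply smooth_continuous, smooth_Derive).
(* Only the end points [L] and [R0] are new; there continuity of the derivative forbids a nonzero
   value next to zeros. *)
intros Hx. destruct (Rtotal_order (Derive phi x) 0) as [N | [E | P]]; [exfalso | exact E | exfalso].
- destruct (continuous_lt_near (Derive phi) x 0 (C x) N) as [e [He Hn]].
  destruct Hx as [Hx | Hx];
    [generalize (Hn (x - e)) | generalize (Hn (x + e))]; rewrite A by lra; lra.
- destruct (continuous_lt_near (fun y => - Derive phi y) x 0) as [e [He Hn]];
    [apply cont_opp, C | lra |].
  destruct Hx as [Hx | Hx];
    [generalize (Hn (x - e)) | generalize (Hn (x + e))]; rewrite A by lra; lra.
Qed.

Lemma RInt_by_parts_0 (f g g' : R -> R) L R0 :
  (forall y, continuous f y) ->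
  (forall y, is_derive g y (g' y)) -> (forall y, continuous g' y) ->
  g L = 0 -> g R0 = 0 ->
  RInt (fun y => f y * g y) L R0 = - RInt (fun y => RInt f 0 y * g' y) L R0.
Proof.
intros Cf Dg Cg' HL HR.
assert (Cg : forall y, continuous g y)
  by (intros; apply (ex_derive_continuous g); eexists; apply Dg).
assert (CF : forall y, continuous (fun y => RInt f 0 y) y)
  by (intros; apply (ex_derive_continuous (fun y => RInt f 0 y)); eexists; now apply is_derive_prim).
assert (C1 : forall y, continuous (fun y => f y * g y) y) by (intros; now apply cont_mult).
assert (C2 : forall y, continuous (fun y => RInt f 0 y * g' y) y) by (intros; now apply cont_mult).
assert (E := RInt_ftc (fun y => RInt f 0 y * g y) (fun y => f y * g y + RInt f 0 y * g' y) L R0).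
rewrite Rint_plus, HL, HR, !Rmult_0_r in E by now apply ex_RInt_cont.
enough (RInt (fun y => f y * g y) L R0 + RInt (fun y => RInt f 0 y * g' y) L R0 = 0 - 0) by lra.
apply E; intros y _.
- apply (is_derive_mult (fun y => RInt f 0 y) g); [now apply is_derive_prim | apply Dg |].
  intros; apply Rmult_comm.
- now apply cont_plus.
Qed.

(** * Pairing under two different weights *)

Section Pairing.
Variables (s tau : R) (v : R -> R) (T : distr) (G H : R -> R).
Hypotheses (Hs : 0 < s) (Htau : 0 < tau) (Cv : forall y, continuous v y)
  (HG : Acs_prim tau T G) (HH : Acs_prim s (distr_sub (fun_distr v) T) H).

Let V (y : R) : R := RInt (fun z => v z * omega s z) 0 y.
Let Q (y : R) : R := RInt (fun z => G z * omega_quot' s tau z) 0 y.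

Let CG y : continuous G y. Proof. apply HG. Qed.
Let CH y : continuous H y. Proof. apply HH. Qed.
Let Cvo y : continuous (fun z => v z * omega s z) y.
Proof. apply cont_mult; [apply Cv | apply continuous_omega]. Qed.
Let CGq y : continuous (fun z => G z * omega_quot s tau z) y.
Proof. apply cont_mult; [apply CG | apply continuous_omega_quot]. Qed.
Let CGq' y : continuous (fun z => G z * omega_quot' s tau z) y.
Proof. apply cont_mult; [apply CG | apply continuous_omega_quot']. Qed.
Let CV y : continuous V y.
Proof. apply (ex_derive_continuous V); eexists; now apply is_derive_prim. Qed.
Let CQ y : continuous Q y.
Proof. apply (ex_derive_continuous Q); eexists; now apply is_derive_prim. Qed.

(** Stated for every C^1 function vanishing at both ends because it serves twice: with test
    functions to prove that the combination is constant, then with cut kernels to exploit this. *)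
Lemma Acs_prim_parts (g g' : R -> R) L R0 :
  (forall y, is_derive g y (g' y)) -> (forall y, continuous g' y) -> g L = 0 -> g R0 = 0 ->
  RInt (fun y => (V y - H y - G y * omega_quot s tau y + Q y) * g' y) L R0 =
  - RInt (fun y => v y * omega s y * g y) L R0 - RInt (fun y => H y * g' y) L R0
  - RInt (fun y => G y * (omega_quot' s tau y * g y + omega_quot s tau y * g' y)) L R0.
Proof.
intros Dg Cg' HL HR.
assert (Cg : forall y, continuous g y)
  by (intros; apply (ex_derive_continuous g); eexists; apply Dg).
rewrite (RInt_by_parts_0 (fun y => v y * omega s y) g g') by assumption.
rewrite (RInt_ext (fun y => G y * _)
  (fun y => G y * omega_quot' s tau y * g y + G y * omega_quot s tau y * g' y))
  by (intros; toR; ring).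
rewrite Rint_plus by (apply ex_RInt_cont; intros; now apply cont_mult).
rewrite (RInt_by_parts_0 (fun y => G y * omega_quot' s tau y) g g') by assumption.

rewrite (RInt_ext _
  (fun y => V y * g' y - H y * g' y - G y * omega_quot s tau y * g' y + Q y * g' y))
  by (intros; toR; ring).
assert (X1 : forall y, continuous (fun y => V y * g' y) y) by (intros; now apply cont_mult).
assert (X2 : forall y, continuous (fun y => H y * g' y) y) by (intros; now apply cont_mult).
assert (X3 : forall y, continuous (fun y => G y * omega_quot s tau y * g' y) y)
  by (intros; now apply cont_mult).
assert (X4 : forall y, continuous (fun y => Q y * g' y) y) by (intros; now apply cont_mult).
rewrite Rint_plus, !Rint_minus by (apply ex_RInt_cont; intros; repeat apply cont_minus; auto).
unfold V, Q. lra.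
Qed.

(** With [q = omega_quot s tau], the hypotheses say [v * omega s = H' + G' q] as distributions, and
    [G' q = (G q)' - G q']. The combination is thus a continuous function with zero distributional
    derivative. *)
Lemma Acs_prim_sub_const a b :
  V a - H a - G a * omega_quot s tau a + Q a = V b - H b - G b * omega_quot s tau b + Q b.
Proof.
apply (du_bois_reymond (fun y => V y - H y - G y * omega_quot s tau y + Q y)).
{ intros y. apply cont_plus; [repeat apply cont_minus|]; auto. }
clear a b. intros L R0 phi HLR Sp H0.
assert (Dp : forall y, is_derive phi y (Derive phi y)) by (intros; now apply smooth_is_derive).
assert (Cp : forall y, continuous phi y) by (intros; now apply smooth_continuous).
assert (Cp' : forall y, continuous (Derive phi) y)
  by (intros; now apply smooth_continuous, smooth_Derive).
rewrite (Acs_prim_parts phi (Derive phi)) by (auto; apply H0; lra).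
assert (Tp := smooth_test_fun phi L R0 Sp H0).
assert (E := proj2 HH phi Tp). unfold distr_sub, fun_distr in E.
(* [HG] evaluates [T] only on [omega tau] times a test function, so the quotient of the weights is
   absorbed into the test function. *)
assert (ET : (fun x => omega s x * phi x) =
  (fun x => omega tau x * (omega_quot s tau x * phi x))).
{ apply functional_extensionality; intros x. rewrite (omega_quotE s tau) by lra. ring. }
rewrite (f_equal T ET) in E.
assert (Sq : smooth (fun x => omega_quot s tau x * phi x))
  by (constructor; [apply smooth_omega_quot | exact Sp]).
assert (Hq : forall x, x <= L \/ R0 <= x -> omega_quot s tau x * phi x = 0)
  by (intros x Hx; rewrite H0 by exact Hx; ring).
rewrite (proj2 HG _ (smooth_test_fun _ L R0 Sq Hq)) in E.
rewrite (Rint_line_compact _ L R0) in E.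
2: { intros x. apply cont_mult; [apply Cv | apply cont_mult; [apply continuous_omega | apply Cp]]. }
2: { intros x Hx. rewrite H0 by exact Hx. ring. }
rewrite (Rint_line_compact (fun x => G x * _) L R0) in E.
2: { intros x. apply cont_mult; [apply CG |]. now apply smooth_continuous, smooth_Derive. }
2: { intros x Hx. rewrite (Derive_0_outside _ L R0) by assumption. ring. }
rewrite (Rint_line_compact (fun x => H x * _) L R0) in E.
2: { intros x. now apply cont_mult. }
2: { intros x Hx. rewrite (Derive_0_outside _ L R0) by assumption. ring. }
rewrite (RInt_ext (fun x => G x * Derive _ x)
  (fun y => G y * (omega_quot' s tau y * phi y + omega_quot s tau y * Derive phi y))) in E.
2: { intros x _. f_equal. apply is_derive_unique.
  apply (is_derive_mult (omega_quot s tau) phi); [apply is_derive_omega_quot | apply Dp |].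
  intros; apply Rmult_comm. }
rewrite (RInt_ext (fun x => v x * (omega s x * phi x)) (fun y => v y * omega s y * phi y)) in E
  by (intros; toR; ring).
lra.
Qed.

(** Here [g] is merely C^1 and controlled only at the two ends, so the distributional identity
    cannot be applied to it. Constancy of the combination replaces it: a constant times [g']
    integrates to 0. *)
Lemma Acs_prim_sub_pairing (g g' : R -> R) L R0 :
  (forall y, is_derive g y (g' y)) -> (forall y, continuous g' y) -> g L = 0 -> g R0 = 0 ->
  RInt (fun y => v y * omega s y * g y) L R0 =
  - RInt (fun y => H y * g' y) L R0
  - RInt (fun y => G y * (omega_quot' s tau y * g y + omega_quot s tau y * g' y)) L R0.
Proof.
intros Dg Cg' HL HR. generalize (Acs_prim_parts g g' L R0 Dg Cg' HL HR).
rewrite (RInt_ext (fun y => (V y - _ - _ + _) * _)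
  (fun y => (V 0 - H 0 - G 0 * omega_quot s tau 0 + Q 0) * g' y)).
2: { intros y _. now rewrite (Acs_prim_sub_const y 0). }
rewrite Rint_scal by now apply ex_RInt_cont.
rewrite (RInt_ftc g g') by auto. rewrite HL, HR. lra.
Qed.
End Pairing.

Lemma Acs_prim_0 tau : Acs_prim tau (fun _ => 0) (fun _ => 0).
Proof.
split.
- split; [intros; apply continuous_const|]. split; [exists 0 |]; apply is_lim_const.
- intros phi _. rewrite (Rint_line_compact _ 0 0).
  + rewrite Rint_0; [ring | intros; ring].
  + intros x. apply (continuous_ext (fun _ => 0)); [intros; toR; ring | apply continuous_const].
  + intros; ring.
Qed.

(** The previous section with the zero distribution: for a continuous function a distributional
    primitive is a classical one. *)
Lemma Acs_prim_is_derive s v Gs y :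
  0 < s -> (forall y, continuous v y) -> Acs_prim s (fun_distr v) Gs ->
  is_derive Gs y (v y * omega s y).
Proof.
intros Hs Cv HG.
assert (HH : Acs_prim s (distr_sub (fun_distr v) (fun _ => 0)) Gs).
{ split; [apply HG|]. intros phi Tp. unfold distr_sub. rewrite (proj2 HG phi Tp). ring. }
assert (E := Acs_prim_sub_const s s v _ _ _ Hs Hs Cv (Acs_prim_0 s) HH).
apply (is_derive_ext (fun y => RInt (fun z => v z * omega s z) 0 y + Gs 0)).
- intros z. specialize (E z 0). rewrite !RInt_point, (Rint_0 (fun z => 0 * _)) in E by (intros; ring).
  change (zero : R) with 0 in E. lra.
- eapply is_derive_eq.
  + apply (is_derive_plus (V := R_NormedModule)).
    * apply (is_derive_prim (fun z => v z * omega s z)).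
      intros z. apply cont_mult; [apply Cv | apply continuous_omega].
    * apply (is_derive_const (V := R_NormedModule)).
  + toR. ring.
Qed.

Lemma Acs_prim_by_parts s v Gs (g g' : R -> R) L R0 :
  0 < s -> (forall y, continuous v y) -> Acs_prim s (fun_distr v) Gs ->
  (forall y, is_derive g y (g' y)) -> (forall y, continuous g' y) ->
  RInt (fun y => v y * omega s y * g y) L R0 =
  Gs R0 * g R0 - Gs L * g L - RInt (fun y => Gs y * g' y) L R0.
Proof.
intros Hs Cv HG Dg Cg'.
assert (Cg : forall y, continuous g y)
  by (intros; apply (ex_derive_continuous g); eexists; apply Dg).
assert (C1 : forall y, continuous (fun y => v y * omega s y * g y) y)
  by (intros; repeat apply cont_mult; auto; apply continuous_omega).
assert (C2 : forall y, continuous (fun y => Gs y * g' y) y)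
  by (intros; apply cont_mult; [apply HG | auto]).
assert (E := RInt_ftc (fun y => Gs y * g y) (fun y => v y * omega s y * g y + Gs y * g' y) L R0).
rewrite Rint_plus in E by now apply ex_RInt_cont.
rewrite <- E; [lra | |].
- intros y _. apply (is_derive_mult Gs g); [now apply Acs_prim_is_derive | apply Dg |].
  intros; apply Rmult_comm.
- intros y _. now apply cont_plus.
Qed.

(** * Cutoff and weighted heat kernel *)

(* The exponent 3 is the least for which [chi], [chi1] and [chi2] all vanish at [r] and [- r],
   which removes the boundary terms of three integrations by parts. *)
Definition chi (r y : R) : R := (1 - (y / r) ^ 2) ^ 3.
Definition chi1 (r y : R) : R := - 6 * y / r ^ 2 * (1 - (y / r) ^ 2) ^ 2.
Definition chi2 (r y : R) : R :=
  - 6 / r ^ 2 * (1 - (y / r) ^ 2) ^ 2 + 24 * y ^ 2 / r ^ 4 * (1 - (y / r) ^ 2).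
Definition chi3 (r y : R) : R :=
  72 * y / r ^ 4 * (1 - (y / r) ^ 2) - 48 * y ^ 3 / r ^ 6.

Lemma is_derive_chi r y : r <> 0 -> is_derive (chi r) y (chi1 r y).
Proof. intros Hr; unfold chi, chi1. auto_derive; [trivial|]. simpl; field; trivial. Qed.

Lemma is_derive_chi1 r y : r <> 0 -> is_derive (chi1 r) y (chi2 r y).
Proof. intros Hr; unfold chi1, chi2. auto_derive; [trivial|]. simpl; field; trivial. Qed.

Lemma is_derive_chi2 r y : r <> 0 -> is_derive (chi2 r) y (chi3 r y).
Proof. intros Hr; unfold chi2, chi3. auto_derive; [trivial|]. simpl; field; trivial. Qed.

Lemma continuous_chi r y : r <> 0 -> continuous (chi r) y.
Proof. intros Hr; unfold chi. cont. Qed.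
Lemma continuous_chi1 r y : r <> 0 -> continuous (chi1 r) y.
Proof. intros Hr; unfold chi1. cont; now apply pow_nonzero. Qed.
Lemma continuous_chi2 r y : r <> 0 -> continuous (chi2 r) y.
Proof. intros Hr; unfold chi2. cont; now apply pow_nonzero. Qed.
Lemma continuous_chi3 r y : r <> 0 -> continuous (chi3 r) y.
Proof. intros Hr; unfold chi3. cont; now apply pow_nonzero. Qed.

Lemma chi_end r e : r <> 0 -> (e = r \/ e = - r) -> chi r e = 0 /\ chi1 r e = 0 /\ chi2 r e = 0.
Proof.
intros Hr He. unfold chi, chi1, chi2.
replace ((e / r) ^ 2) with 1 by (destruct He as [-> | ->]; field; trivial).
repeat split; field; trivial.
Qed.

(** In [w = y / r] the successive derivatives are polynomials times [1 / r], [1 / r ^ 2],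
    [1 / r ^ 3]. The constants are [30 = 24 + 6] and [120 = 72 + 48], and [r >= 1] absorbs the spare
    [1 / r] of [chi3]. *)
Lemma chi_bounds r y : 1 <= r -> Rabs y <= r ->
  0 <= chi r y <= 1 /\ 1 - chi r y <= 3 * y ^ 2 / r ^ 2 /\
  Rabs (chi1 r y) <= 6 * Rabs y / r ^ 2 /\ Rabs (chi2 r y) <= 30 / r ^ 2 /\
  Rabs (chi3 r y) <= 120 / r ^ 2.
Proof.
intros Hr Hy.
set (w := y / r). assert (Ey : y = w * r) by (unfold w; field; lra).
assert (Hw : Rabs w <= 1).
{ unfold w. rewrite Rabs_div by lra. rewrite (Rabs_pos_eq r) by lra.
  apply Rle_div_l; lra. }
assert (Hi : 0 < / r <= 1) by (split; [apply Rinv_0_lt_compat; lra | rewrite <- Rinv_1; apply Rinv_le_contravar; lra]).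
assert (W2 : 0 <= w ^ 2 <= 1) by (rewrite <- pow2_abs; assert (P := Rabs_pos w); nra).
set (p := 1 - w ^ 2). assert (Hp : 0 <= p <= 1) by (unfold p; lra).
assert (Hp2 : 0 <= p ^ 2 <= 1) by nra.
assert (Hi2 : 0 < / r ^ 2) by (apply Rinv_0_lt_compat; nra).
unfold chi, chi1, chi2, chi3. fold w. fold p.
split; [simpl in *; nra|]. split.
{ replace (3 * y ^ 2 / r ^ 2) with (3 * w ^ 2) by (rewrite Ey; field; lra).
  unfold p. simpl in *; nra. }
split; [|split].
- replace (- 6 * y / r ^ 2 * p ^ 2) with (- (6 * y * / r ^ 2 * p ^ 2)) by (unfold Rdiv; ring).
  unfold Rdiv. rewrite Rabs_Ropp, !Rabs_mult, (Rabs_pos_eq 6), (Rabs_pos_eq (/ r ^ 2)),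
    (Rabs_pos_eq (p ^ 2)) by lra.
  assert (Q := Rabs_pos y). assert (0 <= 6 * Rabs y * / r ^ 2) by (apply Rmult_le_pos; lra). nra.
- replace (-6 / r ^ 2 * p ^ 2 + 24 * y ^ 2 / r ^ 4 * p)
    with ((24 * w ^ 2 * p - 6 * p ^ 2) * / r ^ 2) by (rewrite Ey; field; lra).
  rewrite Rabs_mult, (Rabs_pos_eq (/ r ^ 2)) by lra. apply Rmult_le_compat_r; [lra|].
  apply Rabs_le. nra.
- replace (72 * y / r ^ 4 * p - 48 * y ^ 3 / r ^ 6)
    with ((72 * (w * p) - 48 * (w * w ^ 2)) * / r * / r ^ 2) by (rewrite Ey; field; lra).
  rewrite !Rabs_mult, (Rabs_pos_eq (/ r ^ 2)), (Rabs_pos_eq (/ r)) by lra.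
  apply Rmult_le_compat_r; [lra|].
  apply Rabs_le_between in Hw.
  assert (-1 <= w * p <= 1) by nra. assert (-1 <= w * w ^ 2 <= 1) by nra.
  assert (Rabs (72 * (w * p) - 48 * (w * w ^ 2)) <= 120) by (apply Rabs_le; lra).
  assert (Q := Rabs_pos (72 * (w * p) - 48 * (w * w ^ 2))). nra.
Qed.

(** The kernel [h] of [heat_conv] with its exponents merged. For positive [s] and [th] it decays at
    both ends exactly when [th < s]. *)
Definition hker (s x th y : R) : R :=
  / sqrt (4 * PI * th) * exp (- ((x - y) ^ 2) / (4 * th) + y ^ 2 / (4 * s)).

Lemma hkerE s x th y : hker s x th y = Theta th (x - y) / omega s y.
Proof.
unfold hker, Theta, omega, Rdiv. rewrite exp_plus, <- exp_Ropp.
rewrite (Rmult_assoc (/ sqrt _)). apply f_equal, f_equal, f_equal. ring.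
Qed.

Lemma sqrt_4PI_gt_0 th : 0 < th -> 0 < sqrt (4 * PI * th).
Proof. intros H. assert (P := PI_RGT_0). apply sqrt_lt_R0. nra. Qed.

Lemma hker_gt_0 s x th y : 0 < th -> 0 < hker s x th y.
Proof.
intros H; apply Rmult_lt_0_compat; [apply Rinv_0_lt_compat, sqrt_4PI_gt_0, H | apply exp_pos].
Qed.

Lemma exp_le x y : x <= y -> exp x <= exp y.
Proof. intros [H | ->]; [left; now apply exp_increasing | apply Rle_refl]. Qed.

(** The logarithmic derivative of [hker] in [y]: affine, so it costs one power of [y], and its sign
    decides monotonicity. *)
Definition dlog (s x th y : R) : R := (x - y) / (2 * th) + y / (2 * s).

Lemma is_derive_hker s x th y : 0 < s -> 0 < th ->
  is_derive (hker s x th) y (hker s x th y * dlog s x th y).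
Proof.
intros Hs Ht. unfold hker, dlog. assert (P := sqrt_4PI_gt_0 th Ht).
auto_derive; [trivial|].
replace (- ((x - y) ^ 2) / (4 * th) + y ^ 2 / (4 * s))
  with (- ((x + - y) * ((x + - y) * 1)) * / (4 * th) + y * (y * 1) * / (4 * s)) by (field; lra).
simpl. field. lra.
Qed.

Lemma continuous_hker s x th y : 0 < s -> 0 < th -> continuous (hker s x th) y.
Proof.
intros Hs Ht. apply (ex_derive_continuous (hker s x th)). eexists; now apply is_derive_hker.
Qed.

Lemma continuous_dlog s x th y : 0 < s -> 0 < th -> continuous (dlog s x th) y.
Proof. intros Hs Ht; unfold dlog; cont; lra. Qed.

(** The cube pays for the worst term of [wker']: one power each for [dlog], [x - y] and [chi1]. The
    bound is uniform in [th], since [eta] controls the normalising factor and [s'] the exponent. *)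
Lemma hker_bound s s' eta x : 0 < eta -> 0 < s' < s ->
  exists B, 0 < B /\ forall th y, eta <= th <= s' -> (1 + Rabs y) ^ 3 * hker s x th y <= B.
Proof.
intros He Hs.
set (a := / (4 * s')). set (b := / (4 * s)).
assert (Hab : 0 < b < a).
{ unfold a, b. split; [apply Rinv_0_lt_compat; lra | apply Rinv_lt_contravar; [nra | lra]]. }
destruct (pow_le_exp 3) as [C [HC HCz]].
(* The maximum of [- (a - b) * Y ^ 2 + (2 * a * Rabs x + 1) * Y]. The added 1 comes from
   [exp (1 + Rabs y)], which dominates the cube. *)
set (A := (2 * a * Rabs x + 1) ^ 2 / (4 * (a - b))).
exists (/ sqrt (4 * PI * eta) * (C * exp (1 + A))).
assert (Q := sqrt_4PI_gt_0 eta He). assert (Qi := Rinv_0_lt_compat _ Q).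
split; [apply Rmult_lt_0_compat; [exact Qi | apply Rmult_lt_0_compat; [exact HC | apply exp_pos]]|].
intros th y Hth. assert (Pi := PI_RGT_0).
set (m := 1 + Rabs y). assert (Hm : 1 <= m) by (unfold m; assert (P := Rabs_pos y); lra).
unfold hker.
rewrite <- Rmult_assoc, (Rmult_comm (m ^ 3)), Rmult_assoc.
apply Rmult_le_compat.
- left; apply Rinv_0_lt_compat, sqrt_4PI_gt_0; lra.
- apply Rmult_le_pos; [apply pow_le; lra | left; apply exp_pos].
- apply Rinv_le_contravar; [exact Q | apply sqrt_le_1_alt; nra].
- apply Rle_trans with (C * exp m * exp (- ((x - y) ^ 2) / (4 * th) + y ^ 2 / (4 * s))).
  { apply Rmult_le_compat_r; [left; apply exp_pos | apply HCz; lra]. }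
  rewrite Rmult_assoc, <- exp_plus. apply Rmult_le_compat_l; [lra|].
  apply exp_le.
  assert (H1 : - ((x - y) ^ 2) / (4 * th) <= - (x - y) ^ 2 * a).
  { unfold Rdiv. rewrite !Ropp_mult_distr_l_reverse. apply Ropp_le_contravar.
    apply Rmult_le_compat_l; [apply pow2_ge_0|].
    unfold a. apply Rinv_le_contravar; lra. }
  assert (H2 : y ^ 2 / (4 * s) = b * y ^ 2) by (unfold b; field; lra).
  rewrite H2. unfold m.
  enough (Rabs y - (x - y) ^ 2 * a + b * y ^ 2 <= A) by lra.
  set (c := 2 * a * Rabs x + 1) in A.
  assert (H3 : 2 * a * (x * y) <= 2 * a * (Rabs x * Rabs y)).
  { apply Rmult_le_compat_l; [lra|]. rewrite <- Rabs_mult. apply RRle_abs. }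
  assert (H4 : - (a - b) * Rabs y ^ 2 + c * Rabs y <= A).
  { unfold A. apply Rle_div_r; [lra|].
    assert (S := pow2_ge_0 (2 * (a - b) * Rabs y - c)). simpl in *. nra. }
  rewrite pow2_abs in H4. unfold c in H4. assert (S := pow2_ge_0 x). nra.
Qed.

(* What Green's formula leaves of the cutoff: [(2 k_y chi' + k chi'') / omega s], where
   [k = Theta th (x - y)]. *)
Definition wker (s x th r y : R) : R :=
  hker s x th y * ((x - y) / th * chi1 r y + chi2 r y).
Definition wker' (s x th r y : R) : R :=
  hker s x th y * (dlog s x th y * ((x - y) / th * chi1 r y + chi2 r y)
    - chi1 r y / th + (x - y) / th * chi2 r y + chi3 r y).

Lemma is_derive_wker s x th r y : 0 < s -> 0 < th -> r <> 0 ->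
  is_derive (wker s x th r) y (wker' s x th r y).
Proof.
intros Hs Ht Hr. unfold wker, wker'.
assert (D1 : is_derive (fun y => (x - y) / th * chi1 r y + chi2 r y) y
  (- chi1 r y / th + (x - y) / th * chi2 r y + chi3 r y)).
{ eapply is_derive_eq.
  - apply (is_derive_plus (V := R_NormedModule)); [|now apply is_derive_chi2].
    apply (is_derive_mult (fun y => (x - y) / th) (chi1 r) y (- / th)).
    + auto_derive; [trivial | ring].
    + now apply is_derive_chi1.
    + intros; apply Rmult_comm.
  - toR. unfold Rdiv. ring. }
eapply is_derive_eq.
- apply (is_derive_mult (hker s x th)); [now apply is_derive_hker | exact D1 |].
  intros; apply Rmult_comm.
- toR. unfold Rdiv. ring.
Qed.

Lemma continuous_wker' s x th r y : 0 < s -> 0 < th -> r <> 0 -> continuous (wker' s x th r) y.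
Proof.
intros Hs Ht Hr. unfold wker'.
assert (A1 := continuous_hker s x th y Hs Ht). assert (A2 := continuous_dlog s x th y Hs Ht).
assert (B1 := continuous_chi1 r y Hr). assert (B2 := continuous_chi2 r y Hr).
assert (B3 := continuous_chi3 r y Hr). cont; lra.
Qed.

(** The order [1 / r ^ 2] beats the length [2 * r] of the interval of integration; this is the
    source of the [O(1 / r)]. *)
Lemma wker'_bound s s' eta x : 0 < eta -> 0 < s' < s ->
  exists K, 0 < K /\ forall th r y, eta <= th <= s' -> 1 <= r -> Rabs y <= r ->
    Rabs (wker' s x th r y) <= K / r ^ 2.
Proof.
intros He Hs. destruct (hker_bound s s' eta x He Hs) as [B [HB HBy]].
set (k0 := (Rabs x + 1) / (2 * eta) + / (2 * s)). set (k1 := (Rabs x + 1) / eta).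
assert (Px := Rabs_pos x).
assert (Hk0 : 0 < k0).
{ unfold k0. assert (0 < / (2 * s)) by (apply Rinv_0_lt_compat; lra).
  assert (0 < (Rabs x + 1) / (2 * eta)) by (apply Rdiv_lt_0_compat; lra). lra. }
assert (Hk1 : 0 < k1) by (unfold k1; apply Rdiv_lt_0_compat; lra).
assert (Hie : 0 < / eta) by now apply Rinv_0_lt_compat.
(* One summand for each summand of [wker'], where [k0] and [k1] bound [dlog] and [(x - y) / th]
   relative to [1 + Rabs y]. *)
set (k := k0 * (6 * k1 + 30) + 6 * / eta + 30 * k1 + 120).
assert (Hk : 0 < k) by (unfold k; nra).
exists (k * B). split; [nra|]. intros th r y Hth Hr Hy.
destruct (chi_bounds r y Hr Hy) as [_ [_ [H1 [H2 H3]]]].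
set (m := 1 + Rabs y). assert (Py := Rabs_pos y). assert (Hm : 1 <= m) by (unfold m; lra).
assert (Hir : 0 < / r ^ 2) by (apply Rinv_0_lt_compat; nra).
assert (Hit : 0 < / th <= / eta)
  by (split; [apply Rinv_0_lt_compat | apply Rinv_le_contravar]; lra).
assert (Exy : Rabs (x - y) <= (Rabs x + 1) * m).
{ assert (T := Rabs_triang x (- y)). rewrite Rabs_Ropp in T. unfold m, Rminus in *. nra. }
assert (E1 : Rabs ((x - y) / th) <= k1 * m).
{ unfold k1, Rdiv. rewrite Rabs_mult, (Rabs_pos_eq (/ th)) by lra.
  assert (P := Rabs_pos (x - y)). 
  apply Rle_trans with ((Rabs x + 1) * m * / eta); [apply Rmult_le_compat; lra | right; ring]. }
assert (E0 : Rabs (dlog s x th y) <= k0 * m).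
{ unfold dlog. eapply Rle_trans; [apply Rabs_triang|]. unfold k0.
  rewrite Rmult_plus_distr_r. apply Rplus_le_compat.
  - replace ((x - y) / (2 * th)) with ((x - y) / th * / 2) by (field; lra).
    rewrite Rabs_mult, (Rabs_pos_eq (/ 2)) by lra.
    replace ((Rabs x + 1) / (2 * eta) * m) with (k1 * m * / 2) by (unfold k1; field; lra). lra.
  - unfold Rdiv. assert (0 < / (2 * s)) by (apply Rinv_0_lt_compat; lra).
    rewrite Rabs_mult, (Rabs_pos_eq (/ (2 * s))) by lra. unfold m. nra. }
set (i := / r ^ 2) in *.
assert (F1 : Rabs (chi1 r y) <= 6 * m * i).
{ eapply Rle_trans; [exact H1|]. unfold Rdiv. fold i. unfold m. nra. }
unfold Rdiv in H2, H3. fold i in H2, H3.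
assert (F2 : Rabs ((x - y) / th * chi1 r y + chi2 r y) <= (6 * k1 + 30) * (m * m * i)).
{ eapply Rle_trans; [apply Rabs_triang|]. rewrite Rabs_mult.
  assert (Rabs ((x - y) / th) * Rabs (chi1 r y) <= k1 * m * (6 * m * i))
    by (apply Rmult_le_compat; trivial; apply Rabs_pos).
  assert (1 <= m * m) by nra.
  assert (1 * i <= m * m * i) by (apply Rmult_le_compat_r; lra). lra. }
assert (F3 : Rabs (dlog s x th y * ((x - y) / th * chi1 r y + chi2 r y))
  <= k0 * (6 * k1 + 30) * (m ^ 3 * i)).
{ rewrite Rabs_mult.
  apply Rle_trans with (k0 * m * ((6 * k1 + 30) * (m * m * i)));
    [apply Rmult_le_compat; trivial; apply Rabs_pos | right; ring]. }
assert (M1 : m <= m ^ 3) by (simpl; nra). assert (M2 : 1 <= m ^ 3) by (simpl; nra).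
assert (F4 : Rabs (chi1 r y / th) <= 6 * / eta * (m ^ 3 * i)).
{ unfold Rdiv. rewrite Rabs_mult, (Rabs_pos_eq (/ th)) by lra.
  apply Rle_trans with (6 * m * i * / eta); [apply Rmult_le_compat; trivial; [apply Rabs_pos | lra | lra]|].
  replace (6 * / eta * (m ^ 3 * i)) with (6 * m ^ 3 * i * / eta) by ring.
  apply Rmult_le_compat_r; [lra|]. apply Rmult_le_compat_r; lra. }
assert (F5 : Rabs ((x - y) / th * chi2 r y) <= 30 * k1 * (m ^ 3 * i)).
{ rewrite Rabs_mult. apply Rle_trans with (k1 * m * (30 * i));
    [apply Rmult_le_compat; trivial; apply Rabs_pos|].
  replace (k1 * m * (30 * i)) with (30 * k1 * (m * i)) by ring.
  apply Rmult_le_compat_l; [lra|]. apply Rmult_le_compat_r; lra. }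
assert (F6 : Rabs (chi3 r y) <= 120 * (m ^ 3 * i)) by nra.
unfold wker'. rewrite Rabs_mult, (Rabs_pos_eq (hker s x th y)) by (left; apply hker_gt_0; lra).
specialize (HBy th y Hth). fold m in HBy.
apply Rle_trans with (hker s x th y * (k * (m ^ 3 * i))).
- apply Rmult_le_compat_l; [left; apply hker_gt_0; lra|].
  unfold Rminus. eapply Rle_trans; [apply Rabs_triang|].
  eapply Rle_trans; [apply Rplus_le_compat_r, Rabs_triang|].
  eapply Rle_trans; [apply Rplus_le_compat_r, Rplus_le_compat_r, Rabs_triang|].
  rewrite Rabs_Ropp. unfold Rminus in *. unfold k. lra.
- unfold Rdiv. fold i.
  replace (hker s x th y * (k * (m ^ 3 * i))) with (k * (m ^ 3 * hker s x th y) * i) by ring.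
  apply Rmult_le_compat_r; [lra|]. apply Rmult_le_compat_l; lra.
Qed.

(** * The truncated pairing with the backward heat kernel *)

Lemma is_derive_Theta_t th z : 0 < th ->
  is_derive (fun th => Theta th z) th (Theta th z * (z ^ 2 / (4 * th ^ 2) - / (2 * th))).
Proof.
intros Ht. assert (P := sqrt_4PI_gt_0 th Ht). assert (Q := PI_RGT_0).
unfold Theta. auto_derive; [repeat split; try apply Rgt_not_eq; nra|].
simpl. replace (- (z * (z * 1)) * / (4 * th)) with (- (z * (z * 1)) / (4 * th)) by reflexivity.
set (e := exp _). clearbody e.
assert (S : 4 * PI * th = sqrt (4 * PI * th) * sqrt (4 * PI * th)) by (symmetry; apply sqrt_sqrt; nra).
set (q := sqrt (4 * PI * th)) in *.
(* Eliminating [PI] in favour of the root [q] makes the identity rational. *)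
assert (HP : PI = q * q / (4 * th)) by (rewrite <- S; field; lra).
clearbody q. rewrite HP. field. lra.
Qed.

Lemma is_derive_Theta_x x th y : 0 < th ->
  is_derive (fun y => Theta th (x - y)) y (Theta th (x - y) * ((x - y) / (2 * th))).
Proof.
intros Ht. assert (P := sqrt_4PI_gt_0 th Ht).
unfold Theta. auto_derive; [trivial|].
unfold Rminus, Rdiv. simpl. set (e := exp _). clearbody e. field. lra.
Qed.

(** The same factor as in [is_derive_Theta_t]: their agreement is the heat equation for the
    kernel. *)
Lemma is_derive_Theta_xx x th y : 0 < th ->
  is_derive (fun y => Theta th (x - y) * ((x - y) / (2 * th))) y
    (Theta th (x - y) * ((x - y) ^ 2 / (4 * th ^ 2) - / (2 * th))).
Proof.
intros Ht. eapply is_derive_eq.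
- apply (is_derive_mult (fun y => Theta th (x - y)) (fun y => (x - y) / (2 * th)) y
    (Theta th (x - y) * ((x - y) / (2 * th))) (- / (2 * th))).
  + now apply is_derive_Theta_x.
  + auto_derive; [trivial | field; lra].
  + intros; apply Rmult_comm.
- toR. field. lra.
Qed.

Lemma continuous_Theta {U : UniformSpace} (th z : U -> R) p :
  0 < th p -> continuous th p -> continuous z p -> continuous (fun p => Theta (th p) (z p)) p.
Proof.
intros Ht C1 C2. assert (P := sqrt_4PI_gt_0 _ Ht). assert (Q := PI_RGT_0).
unfold Theta. cont; try nra.
Qed.

Lemma RInt_abs_le_const (f : R -> R) r k :
  0 <= r -> (forall y, continuous f y) -> (forall y, Rabs y <= r -> Rabs (f y) <= k) ->
  Rabs (RInt f (- r) r) <= 2 * r * k.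
Proof.
intros Hr Cf H. replace (2 * r) with (r - - r) by ring.
apply (abs_RInt_le_const f (- r) r); [lra | now apply ex_RInt_cont |].
intros y Hy. apply H, Rabs_le, Hy.
Qed.

Section Backward.
Variables (tau x t : R) (u : R -> R -> R).
Hypotheses (Ht : 0 < t < tau)
  (Hreg : forall x t, 0 < t < tau ->
     ex_derive (fun y => u y t) x /\
     ex_derive (fun y => Derive (fun z => u z t) y) x /\
     ex_derive (fun s => u x s) t /\
     continuous (fun p : R * R => u (fst p) (snd p)) (x, t) /\
     continuous (fun p : R * R => Derive (fun z => u z (snd p)) (fst p)) (x, t) /\
     continuous (fun p : R * R =>
        Derive (fun y => Derive (fun z => u z (snd p)) y) (fst p)) (x, t) /\
     continuous (fun p : R * R => Derive (fun s => u (fst p) s) (snd p)) (x, t))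
  (Hheat : forall x t, 0 < t < tau ->
     Derive (fun s => u x s) t - Derive (fun y => Derive (fun z => u z t) y) x = 0).

Let ux y s := Derive (fun z => u z s) y.
Let uxx y s := Derive (fun z => ux z s) y.
Let ut y s := Derive (fun s => u y s) s.

Let reg y s : 0 < s < tau ->
  is_derive (fun y => u y s) y (ux y s) /\ is_derive (fun y => ux y s) y (uxx y s) /\
  is_derive (fun s => u y s) s (ut y s).
Proof.
intros Hs. destruct (Hreg y s Hs) as [H1 [H2 [H3 _]]].
split; [|split]; apply Derive_correct; [exact H1 | exact H2 | exact H3].
Qed.

Let reg2 y s : 0 < s < tau ->
  continuous (fun p : R * R => u (fst p) (snd p)) (y, s) /\
  continuous (fun p : R * R => ux (fst p) (snd p)) (y, s) /\
  continuous (fun p : R * R => uxx (fst p) (snd p)) (y, s) /\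
  continuous (fun p : R * R => ut (fst p) (snd p)) (y, s).
Proof. intros Hs. exact (proj2 (proj2 (proj2 (Hreg y s Hs)))). Qed.

Lemma continuous_slice (h : R -> R -> R) y s :
  continuous (fun p : R * R => h (fst p) (snd p)) (y, s) -> continuous (fun y => h y s) y.
Proof.
intros C. apply (continuous_comp_2 (fun y : R => y) (fun _ => s) h);
  [apply continuous_id | apply continuous_const | exact C].
Qed.

Lemma continuous_swap (h : R -> R -> R) y s :
  continuous (fun p : R * R => h (fst p) (snd p)) (y, s) ->
  continuous (fun p : R * R => h (snd p) (fst p)) (s, y).
Proof.
intros C. apply (continuous_comp_2 (fun p : R * R => snd p) (fun p => fst p) h);
  [apply continuous_snd | apply continuous_fst | exact C].
Qed.

Let Cu y s : 0 < s < tau -> continuous (fun y => u y s) y.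
Proof. intros Hs. exact (continuous_slice u y s (proj1 (reg2 y s Hs))). Qed.
Let Cuxx y s : 0 < s < tau -> continuous (fun y => uxx y s) y.
Proof. intros Hs. exact (continuous_slice uxx y s (proj1 (proj2 (proj2 (reg2 y s Hs))))). Qed.

Definition cut_pairing (r s : R) : R :=
  RInt (fun y => u y s * Theta (t - s) (x - y) * chi r y) (- r) r.

Let D s y := (ut y s * Theta (t - s) (x - y)
   - u y s * (Theta (t - s) (x - y) * ((x - y) ^ 2 / (4 * (t - s) ^ 2) - / (2 * (t - s))))).

Let is_derive_integrand r y s : 0 < s < t ->
  is_derive (fun s => u y s * Theta (t - s) (x - y) * chi r y) s (D s y * chi r y).
Proof.
intros Hs. unfold D.
assert (D1 : is_derive (fun s => Theta (t - s) (x - y)) s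
  (- (Theta (t - s) (x - y) * ((x - y) ^ 2 / (4 * (t - s) ^ 2) - / (2 * (t - s)))))).
{ eapply is_derive_eq.
  - apply (is_derive_comp (fun th => Theta th (x - y)) (fun s => t - s)).
    + apply is_derive_Theta_t. lra.
    + apply (is_derive_minus (V := R_NormedModule) (fun _ => t) (fun s => s)).
      apply (is_derive_const (V := R_NormedModule)). apply (is_derive_id (K := R_AbsRing)).
  - toR. unfold one; simpl. ring. }
eapply is_derive_eq.
- apply (is_derive_mult (fun s => u y s * Theta (t - s) (x - y)) (fun _ => chi r y)).
  + apply (is_derive_mult (fun s => u y s) (fun s => Theta (t - s) (x - y))); [|exact D1|].
    * apply reg. lra.
    * intros; apply Rmult_comm.
  + apply (is_derive_const (V := R_NormedModule)).
  + intros; apply Rmult_comm.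
- toR. unfold ut. ring.
Qed.

Let is_derive_cut_pairing r s : r <> 0 -> 0 < s < t ->
  is_derive (cut_pairing r) s (RInt (fun y => D s y * chi r y) (- r) r).
Proof.
intros Hr Hs.
assert (Hloc : locally s (fun s => 0 < s < t)).
{ apply (locally_interval _ s 0 t); simpl; [lra | lra | tauto]. }
rewrite (RInt_ext (fun y => D s y * chi r y)
  (fun y => Derive (fun s => u y s * Theta (t - s) (x - y) * chi r y) s)).
2: { intros y _. symmetry. now apply is_derive_unique, is_derive_integrand. }
apply (is_derive_RInt_param (fun s y => u y s * Theta (t - s) (x - y) * chi r y) (- r) r s).
- apply (filter_imp _ _ (fun z Hz => fun y _ => ex_intro _ _ (is_derive_integrand r y z Hz)) Hloc).
- intros y _.
  apply (continuity_2d_pt_ext_loc (fun s y => D s y * chi r y)).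
  + destruct Hloc as [e He]. exists e. intros s' y' Hs' _. symmetry.
    apply is_derive_unique, is_derive_integrand, He, Hs'.
  + apply continuity_2d_pt_filterlim.
    change (continuous (fun p : R * R => D (fst p) (snd p) * chi r (snd p)) (s, y)).
    unfold D.
    destruct (reg2 y s) as [C2 [_ [_ C1]]]; [lra|].
    apply (continuous_swap u) in C2. apply (continuous_swap ut) in C1.
    assert (C3 : continuous (fun p : R * R => Theta (t - fst p) (x - snd p)) (s, y)).
    { apply (continuous_Theta (fun p : R * R => t - fst p) (fun p => x - snd p));
        [simpl; lra | cont | cont]. }
    assert (C4 : continuous (fun p : R * R => chi r (snd p)) (s, y)).
    { apply (continuous_comp (fun p : R * R => snd p) (chi r));
        [apply continuous_snd | now apply continuous_chi]. }
    cont; simpl; nra.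
- apply (filter_imp (fun s => 0 < s < t)); [|exact Hloc].
  intros s' Hs'. apply ex_RInt_cont. intros y.
  assert (C1 := Cu y s' ltac:(lra)). assert (C4 := continuous_chi r y Hr).
  assert (C3 : continuous (fun y => Theta (t - s') (x - y)) y).
  { apply (continuous_Theta (fun _ => t - s') (fun y => x - y)); [lra | cont | cont]. }
  cont.
Qed.

(* Green's formula: the cutoff kills the boundary terms, the two kernels solve
   adjoint equations, so that only derivatives of the cutoff remain. *)
Let RInt_green sg r s : 0 < sg -> r <> 0 -> 0 < s < t ->
  RInt (fun y => D s y * chi r y) (- r) r =
  RInt (fun y => u y s * omega sg y * wker sg x (t - s) r y) (- r) r.
Proof.
intros Hsg Hr Hs. assert (Hs' : 0 < s < tau) by lra. assert (Hts : 0 < t - s) by lra.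
set (k := fun y => Theta (t - s) (x - y)).
set (k1 := fun y => Theta (t - s) (x - y) * ((x - y) / (2 * (t - s)))).
set (k2 := fun y => Theta (t - s) (x - y) * ((x - y) ^ 2 / (4 * (t - s) ^ 2) - / (2 * (t - s)))).
assert (Dk : forall y, is_derive k y (k1 y)) by (intros; now apply is_derive_Theta_x).
assert (Dk1 : forall y, is_derive k1 y (k2 y)) by (intros; now apply is_derive_Theta_xx).
assert (Ck : forall y, continuous k y)
  by (intros y; apply (ex_derive_continuous k); eexists; apply Dk).
assert (Ck1 : forall y, continuous k1 y)
  by (intros y; apply (ex_derive_continuous k1); eexists; apply Dk1).
assert (Ck2 : forall y, continuous k2 y).
{ intros y. unfold k2. apply cont_mult; [apply Ck | cont; nra]. }
assert (Du : forall y, is_derive (fun y => u y s) y (ux y s))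
  by (intros; apply reg, Hs').
assert (Dux : forall y, is_derive (fun y => ux y s) y (uxx y s))
  by (intros; apply reg, Hs').
(* Besides the usual flux, the term with [chi1] cancels [ux * k * chi1], so that the remainder [w]
   contains [u] but not [ux], for which no bound is at hand. *)
set (B := fun y => (ux y s * k y - u y s * k1 y) * chi r y - u y s * k y * chi1 r y).
set (w := fun y => u y s * (2 * k1 y * chi1 r y + k y * chi2 r y)).
assert (Cw : forall y, continuous w y).
{ intros y. unfold w. assert (C1 := Cu y s Hs').
  assert (C2 := continuous_chi1 r y Hr). assert (C3 := continuous_chi2 r y Hr).
  assert (C4 := Ck y). assert (C5 := Ck1 y). cont. }
assert (CD : forall y, continuous (fun y => D s y * chi r y) y).
{ intros y. apply (continuous_ext (fun y => (uxx y s * k y - u y s * k2 y) * chi r y)).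
  - intros z. unfold D. f_equal. f_equal. f_equal. symmetry. apply Rminus_diag_uniq, Hheat, Hs'.
  - assert (C1 := Cu y s Hs'). assert (C2 := Cuxx y s Hs').
    assert (C3 := continuous_chi r y Hr). assert (C4 := Ck y). assert (C5 := Ck2 y). cont. }
assert (E : RInt (fun y => D s y * chi r y - w y) (- r) r = B r - B (- r)).
{ apply RInt_ftc; intros y _.
  - unfold B. eapply is_derive_eq.
    + apply (is_derive_minus (V := R_NormedModule)).
      * apply (is_derive_mult (fun y => ux y s * k y - u y s * k1 y) (chi r));
          [|now apply is_derive_chi | intros; apply Rmult_comm].
        apply (is_derive_minus (V := R_NormedModule)).
        -- apply (is_derive_mult (fun y => ux y s) k); [apply Dux | apply Dk | intros; apply Rmult_comm].
        -- apply (is_derive_mult (fun y => u y s) k1); [apply Du | apply Dk1 | intros; apply Rmult_comm].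
      * apply (is_derive_mult (fun y => u y s * k y) (chi1 r));
          [|now apply is_derive_chi1 | intros; apply Rmult_comm].
        apply (is_derive_mult (fun y => u y s) k); [apply Du | apply Dk | intros; apply Rmult_comm].
    + toR. change (D s y) with (ut y s * k y - u y s * k2 y). unfold w.
      replace (ut y s) with (uxx y s) by (symmetry; apply Rminus_diag_uniq, Hheat, Hs'). ring.
  - apply cont_minus; [apply CD | apply Cw]. }
rewrite Rint_minus in E by now apply ex_RInt_cont.
assert (Z : B r = 0 /\ B (- r) = 0).
{ unfold B. destruct (chi_end r r Hr) as [-> [-> _]]; [now left|].
  destruct (chi_end r (- r) Hr) as [-> [-> _]]; [now right|]. split; ring. }
transitivity (RInt w (- r) r); [lra|].
apply RInt_ext. intros y _. unfold w, wker, k, k1. rewrite hkerE.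
assert (P := exp_pos (- y ^ 2 / (4 * sg))). fold (omega sg y) in P.
set (T := Theta (t - s) (x - y)). set (o := omega sg y) in *.
set (c1 := chi1 r y). set (c2 := chi2 r y). clearbody T o c1 c2. toR. field. lra.
Qed.

(** The time lag [t - s] stays between [t - b], which avoids the singularity, and [s' < sg], which
    gives decay. The constant is independent of [a] as well as of [r], so [a] may later tend to
    0. *)
Lemma cut_pairing_lipschitz sg s' M b : 0 < s' < sg -> b < t ->
  (forall s, 0 < s <= b -> t - s' <= s -> exists Gs,
     Acs_prim sg (fun_distr (fun y => u y s)) Gs /\ forall y, Rabs (Gs y) <= M) ->
  exists K, forall r a, 1 <= r -> 0 < a <= b -> t - s' <= a ->
    Rabs (cut_pairing r b - cut_pairing r a) <= K / r.
Proof.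
intros Hs' Hb HG.
destruct (wker'_bound sg s' (t - b) x) as [K [HK HKy]]; [lra | lra |].
exists (2 * Rabs M * K * tau). intros r a Hr Ha Hat.
assert (Hir : 0 < / r) by (apply Rinv_0_lt_compat; lra).
assert (Bd : forall s, a <= s <= b -> Rabs (RInt (fun y => D s y * chi r y) (- r) r) <= 2 * Rabs M * K / r).
{ intros s Hs. rewrite (RInt_green sg) by lra.
  destruct (HG s) as [Gs [HGs HM]]; [lra | lra |].
  assert (Z : wker sg x (t - s) r (- r) = 0 /\ wker sg x (t - s) r r = 0).
  { unfold wker. destruct (chi_end r r) as [_ [-> ->]]; [lra | now left |].
    destruct (chi_end r (- r)) as [_ [-> ->]]; [lra | now right |]. split; ring. }
  rewrite (Acs_prim_by_parts sg (fun y => u y s) Gs (wker sg x (t - s) r) (wker' sg x (t - s) r)).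
  - rewrite (proj1 Z), (proj2 Z), !Rmult_0_r, Rminus_0_r, Rminus_0_l, Rabs_Ropp.
    replace (2 * Rabs M * K / r) with (2 * r * (Rabs M * (K / r ^ 2))) by (field; lra).
    apply RInt_abs_le_const; [lra | |].
    + intros y. apply cont_mult; [apply HGs | apply continuous_wker'; lra].
    + intros y Hy. rewrite Rabs_mult. apply Rmult_le_compat; try apply Rabs_pos.
      * apply Rle_trans with (1 := HM y), RRle_abs.
      * apply HKy; lra.
  - lra.
  - intros y; apply Cu; lra.
  - exact HGs.
  - intros y; apply is_derive_wker; lra.
  - intros y; apply continuous_wker'; lra. }
destruct (MVT_gen (cut_pairing r) a b (fun s => RInt (fun y => D s y * chi r y) (- r) r)) as [c [Hc E]].
- rewrite Rmin_left, Rmax_right by lra. intros s Hs. apply is_derive_cut_pairing; lra.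
- rewrite Rmin_left, Rmax_right by lra. intros s Hs.
  apply continuity_pt_filterlim, (ex_derive_continuous (cut_pairing r) s).
  eexists. apply is_derive_cut_pairing; lra.
- rewrite Rmin_left, Rmax_right in Hc by lra.
  rewrite E, Rabs_mult, (Rabs_pos_eq (b - a)) by lra.
  replace (2 * Rabs M * K * tau / r) with (2 * Rabs M * K / r * tau) by (field; lra).
  apply Rmult_le_compat; [apply Rabs_pos | lra | now apply Bd | lra].
Qed.
End Backward.

(** * Concentration of the kernel *)

Lemma gauss_half_opp r : gauss_half (- r) = - gauss_half r.
Proof.
enough (H : gauss_half (- r) + gauss_half r = gauss_half (- 0) + gauss_half 0).
{ rewrite Ropp_0 in H. unfold gauss_half at 3 4 in H. rewrite RInt_point in H.
  change (zero : R) with 0 in H. lra. }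
apply (is_derive_0_const (fun r => gauss_half (- r) + gauss_half r)). intros z.
eapply is_derive_eq.
- apply (is_derive_plus (V := R_NormedModule)); [|apply is_derive_gauss_half].
  apply (is_derive_comp gauss_half Ropp); [apply is_derive_gauss_half|].
  apply (is_derive_opp (V := R_NormedModule) (fun z => z)), (is_derive_id (K := R_AbsRing)).
- toR. unfold one; simpl. replace (- z * (- z * 1)) with (z * (z * 1)) by ring. ring.
Qed.

Lemma RInt_Theta x d th : 0 < th ->
  RInt (fun y => Theta th (x - y)) (x - d) (x + d) = 2 / sqrt PI * gauss_half (d / (2 * sqrt th)).
Proof.
intros Ht. assert (HP := PI_RGT_0). assert (P := sqrt_lt_R0 _ HP). assert (Q := sqrt_lt_R0 _ Ht).
rewrite (RInt_ftc (fun y => / sqrt PI * gauss_half ((y - x) / (2 * sqrt th)))).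
- replace ((x - d - x) / (2 * sqrt th)) with (- (d / (2 * sqrt th))) by (field; lra).
  replace ((x + d - x) / (2 * sqrt th)) with (d / (2 * sqrt th)) by (field; lra).
  rewrite gauss_half_opp. real_eq. field. lra.
- intros y _. eapply is_derive_eq.
  + apply (is_derive_scal (fun y => gauss_half ((y - x) / (2 * sqrt th)))).
    apply (is_derive_comp gauss_half (fun y => (y - x) / (2 * sqrt th))); [apply is_derive_gauss_half|].
    instantiate (1 := / (2 * sqrt th)). auto_derive; [trivial | field; lra].
  + assert (E1 : sqrt (4 * PI * th) = 2 * sqrt PI * sqrt th).
    { rewrite !sqrt_mult by nra. f_equal. f_equal. replace 4 with (2 ^ 2) by ring.
      apply sqrt_pow2; lra. }
    assert (E2 : - ((y - x) / (2 * sqrt th)) ^ 2 = - (x - y) ^ 2 / (4 * th)).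
    { rewrite <- (sqrt_sqrt th) at 2 by lra. field. lra. }
    unfold Theta. rewrite E1, <- E2. set (e := exp _). clearbody e. toR. field. lra.
- intros y _. apply (continuous_Theta (fun _ => th) (fun y => x - y)); [exact Ht | cont | cont].
Qed.

Lemma RInt_Theta_lim x d eps : 0 < d -> 0 < eps ->
  exists th0, 0 < th0 /\ forall th, 0 < th < th0 ->
    Rabs (RInt (fun y => Theta th (x - y)) (x - d) (x + d) - 1) < eps.
Proof.
intros Hd He. assert (HP := PI_RGT_0). assert (P := sqrt_lt_R0 _ HP).
assert (L := is_lim_gauss_half). apply is_lim_spec in L.
assert (He' : 0 < eps * sqrt PI / 2) by (apply Rdiv_lt_0_compat; nra).
destruct (L (mkposreal _ He')) as [N HN]. simpl in HN.
(* A positive [n >= N], so that [th < (d / (2 * n)) ^ 2] gives [d / (2 * sqrt th) > n >= N]. *)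
set (n := Rmax N 1). assert (Hn : 1 <= n) by apply Rmax_r.
exists ((d / (2 * n)) ^ 2).
assert (Hdn : 0 < d / (2 * n)) by (apply Rdiv_lt_0_compat; lra).
split; [now apply pow_lt|]. intros th Hth.
rewrite RInt_Theta by lra.
assert (Q := sqrt_lt_R0 th ltac:(lra)).
assert (Hs : sqrt th < d / (2 * n)).
{ rewrite <- (sqrt_pow2 (d / (2 * n))) by lra. apply sqrt_lt_1_alt; lra. }
assert (HNd : N < d / (2 * sqrt th)).
{ apply Rle_lt_trans with n; [apply Rmax_l|]. apply Rlt_div_r; [lra|].
  apply Rlt_div_r in Hs; lra. }
specialize (HN _ HNd).
replace (2 / sqrt PI * gauss_half (d / (2 * sqrt th)) - 1)
  with (2 / sqrt PI * (gauss_half (d / (2 * sqrt th)) - sqrt PI / 2)) by (field; lra).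
assert (H2 : 0 < 2 / sqrt PI) by (apply Rdiv_lt_0_compat; lra).
rewrite Rabs_mult, (Rabs_pos_eq (2 / sqrt PI)) by lra.
replace eps with (2 / sqrt PI * (eps * sqrt PI / 2)) by (field; lra).
now apply Rmult_lt_compat_l.
Qed.

(** Integrating [u * omega s] against it gives [cut_pairing], in the form to which primitives
    apply. *)
Definition gker (s x th r y : R) : R := hker s x th y * chi r y.
Definition gker' (s x th r y : R) : R :=
  hker s x th y * (dlog s x th y * chi r y + chi1 r y).

Lemma is_derive_gker s x th r y : 0 < s -> 0 < th -> r <> 0 ->
  is_derive (gker s x th r) y (gker' s x th r y).
Proof.
intros Hs Ht Hr. eapply is_derive_eq.
- apply (is_derive_mult (hker s x th) (chi r)); [now apply is_derive_hker | now apply is_derive_chi |].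
  intros; apply Rmult_comm.
- toR. unfold gker'. ring.
Qed.

Lemma continuous_gker' s x th r y : 0 < s -> 0 < th -> r <> 0 -> continuous (gker' s x th r) y.
Proof.
intros Hs Ht Hr. unfold gker'.
assert (A1 := continuous_hker s x th y Hs Ht). assert (A2 := continuous_dlog s x th y Hs Ht).
assert (B1 := continuous_chi r y Hr). assert (B2 := continuous_chi1 r y Hr). cont.
Qed.

Lemma gker_ends s x th r : r <> 0 -> gker s x th r (- r) = 0 /\ gker s x th r r = 0.
Proof.
intros Hr. unfold gker. destruct (chi_end r r Hr) as [-> _]; [now left|].
destruct (chi_end r (- r) Hr) as [-> _]; [now right|]. split; ring.
Qed.

(* [sg] is the sign of the derivative of the monotone kernel on [[a, b]]. *)
Lemma tail_bound s x th v Gs M m sg r a b : 0 < s -> 0 < th -> 1 <= r -> - r <= a -> a <= b -> b <= r ->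
  (forall y, continuous v y) -> Acs_prim s (fun_distr v) Gs -> (forall y, Rabs (Gs y) <= M) ->
  (sg = 1 \/ sg = -1) -> (forall y, a <= y <= b -> 0 <= sg * dlog s x th y) ->
  (forall y, a <= y <= b -> hker s x th y <= m) ->
  Rabs (RInt (fun y => v y * omega s y * gker s x th r y) a b) <= 15 * M * m.
Proof.
intros Hs Ht Hr Ha Hab Hb Cv HG HM Hsg Hd Hm.
assert (HM0 : 0 <= M) by (apply Rle_trans with (2 := HM 0), Rabs_pos).
assert (Hh : forall y, 0 < hker s x th y) by (intros; now apply hker_gt_0).
assert (Hm0 : 0 < m) by (apply Rlt_le_trans with (1 := Hh a), Hm; lra).
rewrite (Acs_prim_by_parts s v Gs (gker s x th r) (gker' s x th r)); trivial.
2: { intros; apply is_derive_gker; lra. }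
2: { intros; apply continuous_gker'; lra. }
assert (Hg : forall y, a <= y <= b -> Rabs (Gs y * gker s x th r y) <= M * m).
{ intros y Hy. rewrite Rabs_mult. apply Rmult_le_compat; try apply Rabs_pos; [apply HM|].
  unfold gker. destruct (chi_bounds r y Hr) as [Hc _]; [apply Rabs_le; lra|].
  rewrite Rabs_pos_eq by (apply Rmult_le_pos; [left; apply Hh | lra]).
  specialize (Hh y). specialize (Hm y Hy). nra. }
assert (CI : forall y, continuous (fun y => Gs y * gker' s x th r y) y)
  by (intros; apply cont_mult; [apply HG | apply continuous_gker'; lra]).
(* A primitive of a majorant of the integrand. The constant 15 collects 2 from the boundary terms, 1
   from the variation of the monotone kernel and 12 from [6 / r] over a length at most [2 * r]. *)
set (F := fun y => M * (sg * hker s x th y + 6 / r * m * y)).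
assert (I : Rabs (RInt (fun y => Gs y * gker' s x th r y) a b) <= F b - F a).
{ rewrite <- (RInt_ftc F (fun y => M * (sg * (hker s x th y * dlog s x th y) + 6 / r * m))).
  - eapply Rle_trans; [apply abs_RInt_le; [exact Hab | now apply ex_RInt_cont]|].
    apply RInt_le; [exact Hab | | |].
    + apply ex_RInt_cont; intros y. apply (continuous_comp (fun y => Gs y * gker' s x th r y) Rabs).
      apply CI. apply continuous_Rabs.
    + apply ex_RInt_cont; intros y. assert (A1 := continuous_hker s x th y Hs Ht).
      assert (A2 := continuous_dlog s x th y Hs Ht). cont.
    + intros y Hy. rewrite Rabs_mult. apply Rmult_le_compat; try apply Rabs_pos; [apply HM|].
      unfold gker'. rewrite Rabs_mult, (Rabs_pos_eq (hker s x th y)) by (left; apply Hh).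
      destruct (chi_bounds r y Hr) as [Hc [_ [Hc1 _]]]; [apply Rabs_le; lra|].
      assert (Hyr : Rabs y <= r) by (apply Rabs_le; lra).
      assert (Hir : 0 < / r) by (apply Rinv_0_lt_compat; lra).
      assert (Ha1 : Rabs (dlog s x th y * chi r y) <= sg * dlog s x th y).
      { rewrite Rabs_mult, (Rabs_pos_eq (chi r y)) by lra.
        replace (Rabs (dlog s x th y)) with (sg * dlog s x th y).
        - assert (D := Hd y ltac:(lra)). nra.
        - assert (D := Hd y ltac:(lra)).
          destruct Hsg as [-> | ->]; [rewrite Rabs_pos_eq | rewrite Rabs_left1]; lra. }
      assert (Ha2 : Rabs (chi1 r y) <= 6 / r).
      { eapply Rle_trans; [exact Hc1|].
        replace (6 / r) with (6 * r / r ^ 2) by (field; lra).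
        unfold Rdiv. apply Rmult_le_compat_r; [left; apply Rinv_0_lt_compat; nra | lra]. }
      assert (T := Rabs_triang (dlog s x th y * chi r y) (chi1 r y)).
      assert (B1 := Hh y). assert (B2 := Hm y ltac:(lra)).
      assert (Hr6 : 0 < 6 / r) by (unfold Rdiv; lra).
      apply Rle_trans with (hker s x th y * (sg * dlog s x th y + 6 / r)).
      * apply Rmult_le_compat_l; lra.
      * assert (hker s x th y * (6 / r) <= m * (6 / r)) by (apply Rmult_le_compat_r; lra). lra.
  - intros y _. unfold F. apply (is_derive_scal (fun y => sg * hker s x th y + 6 / r * m * y)).
    apply (is_derive_plus (fun y => sg * hker s x th y) (fun y => 6 / r * m * y)).
    + apply (is_derive_scal (hker s x th)). now apply is_derive_hker.
    + auto_derive; [trivial | ring].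
  - intros y _. assert (A1 := continuous_hker s x th y Hs Ht).
    assert (A2 := continuous_dlog s x th y Hs Ht). cont. }
assert (J : F b - F a <= 13 * M * m).
{ unfold F. assert (sg * (hker s x th b - hker s x th a) <= m).
  { assert (X1 := Hh a). assert (X2 := Hh b). assert (X3 := Hm a ltac:(lra)).
    assert (X4 := Hm b ltac:(lra)). destruct Hsg as [-> | ->]; lra. }
  assert (6 / r * m * (b - a) <= 12 * m).
  { replace (12 * m) with (6 / r * m * (2 * r)) by (field; lra).
    apply Rmult_le_compat_l; [|lra].
    apply Rmult_le_pos; [left; apply Rdiv_lt_0_compat; lra | lra]. }
  nra. }
assert (G1 := Hg a ltac:(lra)). assert (G2 := Hg b ltac:(lra)).
unfold Rminus. eapply Rle_trans; [apply Rabs_triang|]. rewrite Rabs_Ropp.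
eapply Rle_trans; [apply Rplus_le_compat_r, Rabs_triang|]. rewrite Rabs_Ropp. lra.
Qed.

Lemma hker_away_lim s x d eps : 0 < d -> 0 < eps ->
  exists th0, 0 < th0 /\ forall th, 0 < th < th0 -> hker s x th (x + d) < eps /\ hker s x th (x - d) < eps.
Proof.
intros Hd He.
set (c := exp ((x + d) ^ 2 / (4 * s)) + exp ((x - d) ^ 2 / (4 * s))).
assert (c1 := exp_pos ((x + d) ^ 2 / (4 * s))). assert (c2 := exp_pos ((x - d) ^ 2 / (4 * s))).
assert (Hc : 0 < c) by (unfold c; lra).
(* From [/ sqrt (4 * PI * th) <= / th] and [exp (- z) <= / (z / 2) ^ 2] with [z = d ^ 2 / (4 * th)],
   the kernel at [x + d] and [x - d] is at most [k * th]. *)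
set (k := 64 / d ^ 4 * c).
assert (Hk : 0 < k) by (apply Rmult_lt_0_compat; [apply Rdiv_lt_0_compat; [lra | now apply pow_lt] | exact Hc]).
exists (Rmin 1 (eps / k)).
assert (Hek : 0 < eps / k) by now apply Rdiv_lt_0_compat.
split; [apply Rmin_pos; lra|]. intros th [Ht Ht1].
assert (Hth1 : th < 1) by (apply Rlt_le_trans with (1 := Ht1), Rmin_l).
assert (Hth2 : th * k < eps).
{ apply (Rlt_div_r th eps k Hk). apply Rlt_le_trans with (1 := Ht1), Rmin_r. }
assert (PI3 := PI_RGT_0). assert (PI4 := PI2_1).
assert (S : / sqrt (4 * PI * th) <= / th).
{ apply Rinv_le_contravar; [exact Ht|]. rewrite <- (sqrt_pow2 th) at 1 by lra.
  apply sqrt_le_1_alt. nra. }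
assert (Si : 0 < / sqrt (4 * PI * th)) by (apply Rinv_0_lt_compat, sqrt_4PI_gt_0, Ht).
set (z := d ^ 2 / (4 * th)).
assert (Hz : 0 < z) by (apply Rdiv_lt_0_compat; [now apply pow_lt | lra]).
assert (Ez : exp (- z) <= 64 * th ^ 2 / d ^ 4).
{ rewrite exp_Ropp. replace (64 * th ^ 2 / d ^ 4) with (/ ((z / 2) ^ 2)) by (unfold z; field; lra).
  apply Rinv_le_contravar; [apply pow_lt; lra|].
  replace z with (z / 2 + z / 2) at 2 by field. rewrite exp_plus.
  assert (X := exp_ineq1_le (z / 2)). nra. }
assert (Main : / sqrt (4 * PI * th) * exp (- z) * c < eps).
{ apply Rle_lt_trans with (2 := Hth2).
  apply Rle_trans with (/ th * (64 * th ^ 2 / d ^ 4) * c).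
  - apply Rmult_le_compat_r; [lra|]. apply Rmult_le_compat; [lra | left; apply exp_pos | exact S | exact Ez].
  - right. unfold k. field. lra. }
assert (Pz : 0 < / sqrt (4 * PI * th) * exp (- z)) by (apply Rmult_lt_0_compat; [exact Si | apply exp_pos]).
split; (eapply Rle_lt_trans; [|exact Main]); unfold hker; rewrite exp_plus, <- Rmult_assoc.
- replace (- (x - (x + d)) ^ 2 / (4 * th)) with (- z) by (unfold z; field; lra).
  apply Rmult_le_compat_l; unfold c; lra.
- replace (- (x - (x - d)) ^ 2 / (4 * th)) with (- z) by (unfold z; field; lra).
  apply Rmult_le_compat_l; unfold c; lra.
Qed.

(** The sign is that of [th * y - s * (y - x)], nonincreasing in [y] as [th <= s]; the bound on [th]
    settles the worst case [y = x + d]. *)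
Lemma dlog_right s x th d y : 0 < s -> 0 < d -> 0 < th <= s * d / (Rabs x + d) -> x + d <= y ->
  dlog s x th y <= 0.
Proof.
intros Hs Hd Ht Hy. unfold dlog. assert (P := Rabs_pos x). assert (Q := RRle_abs x).
assert (H : th * (Rabs x + d) <= s * d) by (apply (Rle_div_r th (s * d)); lra).
assert (th <= s) by nra.
replace ((x - y) / (2 * th) + y / (2 * s)) with ((th * y - s * (y - x)) / (2 * th * s)) by (field; lra).
apply Rle_div_l; [nra|]. nra.
Qed.

Lemma dlog_left s x th d y : 0 < s -> 0 < d -> 0 < th <= s * d / (Rabs x + d) -> y <= x - d ->
  0 <= dlog s x th y.
Proof.
intros Hs Hd Ht Hy. assert (H := dlog_right s (- x) th d (- y) Hs Hd).
rewrite Rabs_Ropp in H. specialize (H Ht ltac:(lra)). unfold dlog in *.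
replace ((- x - - y) / (2 * th) + - y / (2 * s)) with (- ((x - y) / (2 * th) + y / (2 * s))) in H
  by (field; lra). lra.
Qed.

Lemma hker_MVT s x th a b : 0 < s -> 0 < th -> a <= b ->
  exists c, a <= c <= b /\ hker s x th b - hker s x th a = hker s x th c * dlog s x th c * (b - a).
Proof.
intros Hs Ht Hab.
destruct (MVT_gen (hker s x th) a b (fun y => hker s x th y * dlog s x th y)) as [c [Hc E]].
- intros; now apply is_derive_hker.
- intros; now apply continuity_pt_filterlim, continuous_hker.
- rewrite Rmin_left, Rmax_right in Hc by exact Hab. now exists c.
Qed.

(* As [b] tends to [t] the kernel concentrates at [x]; outside [[x - d, x + d]] it is
   monotone, so only its values at [x - d] and [x + d] matter. *)
Lemma cut_pairing_terminal x t u sg M eps : 0 < t -> 0 < sg -> 0 < eps ->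
  continuous (fun p : R * R => u (fst p) (snd p)) (x, t) ->
  (forall s y, 0 < s < t -> continuous (fun y => u y s) y) ->
  (forall s, 0 < s < t -> exists Gs,
     Acs_prim sg (fun_distr (fun y => u y s)) Gs /\ forall y, Rabs (Gs y) <= M) ->
  exists b r0, 0 < b < t /\ forall r, r0 <= r -> Rabs (cut_pairing x t u r b - u x t) <= eps.
Proof.
intros Ht Hsg Heps Cxt Cu HG.
assert (HM0 : 0 <= M).
{ destruct (HG (t / 2)) as [Gs [_ HM]]; [lra|]. apply Rle_trans with (2 := HM 0), Rabs_pos. }
(* Seven parts: one for each tail, one for the defect of the kernel mass on the window, and four for
   the window itself, where the integrand errs by [2 * e] times a kernel of mass at most 2. *)
set (e := eps / 7). assert (He : 0 < e) by (unfold e; lra).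
set (c := u x t). set (K := Rabs c + 1). assert (HK : 1 <= K) by (unfold K; assert (P := Rabs_pos c); lra).
assert (Loc : exists d, 0 < d /\ forall y s, Rabs (y - x) <= d -> Rabs (s - t) <= d -> Rabs (u y s - c) <= e).
{ destruct (Cxt (fun z => Rabs (z - c) < e)) as [d Hd].
  { exists (mkposreal e He). intros z Hz. exact Hz. }
  exists (d / 2). assert (Pd := cond_pos d). split; [lra|]. intros y s Hy Hs. left.
  apply (Hd (y, s)). split; simpl.
  - change (Rabs (y - x) < d). lra.
  - change (Rabs (s - t) < d). lra. }
destruct Loc as [d [Hd Loc]].
set (m := e / (15 * (M + 1))). assert (Hm : 0 < m) by (apply Rdiv_lt_0_compat; lra).
assert (HMm : 15 * M * m <= e).
{ replace e with (15 * (M + 1) * m) by (unfold m; field; lra). nra. }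
assert (He2 : 0 < Rmin 1 (e / K)) by (apply Rmin_pos; [lra | apply Rdiv_lt_0_compat; lra]).
destruct (RInt_Theta_lim x d _ Hd He2) as [th1 [Hth1 Hmass]].
destruct (hker_away_lim sg x d m Hd Hm) as [th2 [Hth2 Haway]].
set (th3 := sg * d / (Rabs x + d)). assert (Px := Rabs_pos x).
assert (Hth3 : 0 < th3) by (apply Rdiv_lt_0_compat; nra).
assert (Th : exists th, 0 < th /\ th < th1 /\ th < th2 /\ th <= th3 /\ th <= d /\ th < t).
{ set (n := Rmin (Rmin th1 th2) (Rmin th3 (Rmin d t))).
  assert (Hn : 0 < n) by (repeat apply Rmin_pos; lra).
  assert (n <= th1 /\ n <= th2 /\ n <= th3 /\ n <= d /\ n <= t).
  { assert (N1 := Rmin_l (Rmin th1 th2) (Rmin th3 (Rmin d t))).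
    assert (N2 := Rmin_r (Rmin th1 th2) (Rmin th3 (Rmin d t))). fold n in N1, N2.
    assert (N3 := Rmin_l th1 th2). assert (N4 := Rmin_r th1 th2).
    assert (N5 := Rmin_l th3 (Rmin d t)). assert (N6 := Rmin_r th3 (Rmin d t)).
    assert (N7 := Rmin_l d t). assert (N8 := Rmin_r d t). lra. }
  exists (n / 2). lra. }
destruct Th as [th [Hth [Ht1 [Ht2 [Ht3 [Htd Htt]]]]]].
specialize (Hmass th (conj Hth Ht1)). destruct (Haway th (conj Hth Ht2)) as [Aw1 Aw2].
set (b := t - th). assert (Hb : 0 < b < t) by (unfold b; lra).
set (X := Rabs x + d). assert (HX : 0 < X) by (unfold X; lra).
(* It makes [[- r, r]] contain the window and forces [1 - chi r y <= 3 * X ^ 2 / r ^ 2 <= e / K]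
   there. *)
set (r0 := 1 + X + 3 * X ^ 2 * K / e).
assert (Hr3 : 0 < 3 * X ^ 2 * K / e).
{ apply Rdiv_lt_0_compat; [|exact He]. apply Rmult_lt_0_compat; [|lra].
  apply Rmult_lt_0_compat; [lra | now apply pow_lt]. }
exists b, r0. split; [exact Hb|]. intros r Hr.
assert (Hr1 : 1 <= r) by (unfold r0 in Hr; lra).
assert (HrX : X <= r) by (unfold r0 in Hr; lra).
assert (Xa := proj1 (Rabs_le_between x (Rabs x)) (Rle_refl _)).
assert (HG' := HG b Hb). destruct HG' as [Gs [HGs HM]].
assert (Cv := fun y => Cu b y Hb).
assert (Ck : forall y, continuous (fun y => Theta th (x - y)) y).
{ intros y. apply (continuous_Theta (fun _ => th) (fun y => x - y)); [exact Hth | cont | cont]. }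
assert (CI : forall y, continuous (fun y => u y b * Theta th (x - y) * chi r y) y).
{ intros y. assert (C1 := Cv y). assert (C2 := Ck y). assert (C3 := continuous_chi r y ltac:(lra)). cont. }
assert (Eg : forall p q, RInt (fun y => u y b * Theta th (x - y) * chi r y) p q =
  RInt (fun y => u y b * omega sg y * gker sg x th r y) p q).
{ intros p q. apply RInt_ext. intros y _. unfold gker. rewrite hkerE.
  assert (P := exp_pos (- y ^ 2 / (4 * sg))). fold (omega sg y) in P. real_eq. field. lra. }
assert (TR : Rabs (RInt (fun y => u y b * Theta th (x - y) * chi r y) (x + d) r) <= e).
{ rewrite Eg. apply Rle_trans with (2 := HMm).
  apply (tail_bound sg x th (fun y => u y b) Gs M m (-1) r); trivial; unfold X in *; try lra.
  - intros y Hy. assert (D := dlog_right sg x th d y Hsg Hd (conj Hth Ht3)). lra.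
  - intros y Hy. destruct (hker_MVT sg x th (x + d) y Hsg Hth) as [z [Hz E]]; [lra|].
    assert (D := dlog_right sg x th d z Hsg Hd (conj Hth Ht3) ltac:(lra)).
    assert (P := hker_gt_0 sg x th z Hth).
    assert (hker sg x th z * dlog sg x th z <= 0) by nra. nra. }
assert (TL : Rabs (RInt (fun y => u y b * Theta th (x - y) * chi r y) (- r) (x - d)) <= e).
{ rewrite Eg. apply Rle_trans with (2 := HMm).
  apply (tail_bound sg x th (fun y => u y b) Gs M m 1 r); trivial; unfold X in *; try lra.
  - intros y Hy. assert (D := dlog_left sg x th d y Hsg Hd (conj Hth Ht3)). lra.
  - intros y Hy. destruct (hker_MVT sg x th y (x - d) Hsg Hth) as [z [Hz E]]; [lra|].
    assert (D := dlog_left sg x th d z Hsg Hd (conj Hth Ht3) ltac:(lra)).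
    assert (P := hker_gt_0 sg x th z Hth).
    assert (0 <= hker sg x th z * dlog sg x th z) by nra. nra. }
assert (TM : Rabs (RInt (fun y => u y b * Theta th (x - y) * chi r y) (x - d) (x + d)
  - c * RInt (fun y => Theta th (x - y)) (x - d) (x + d)) <= 4 * e).
{ rewrite <- Rint_scal by now apply ex_RInt_cont.
  assert (Cck : forall y, continuous (fun y => c * Theta th (x - y)) y)
    by (intros y; assert (C2 := Ck y); cont).
  rewrite <- Rint_minus by now apply ex_RInt_cont.
  apply Rle_trans with (RInt (fun y => 2 * e * Theta th (x - y)) (x - d) (x + d)).
  - eapply Rle_trans; [apply abs_RInt_le; [lra | apply ex_RInt_cont; intros; now apply cont_minus]|].
    apply RInt_le; [lra | | |].
    + apply ex_RInt_cont; intros y.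
      apply (continuous_comp (fun y => u y b * Theta th (x - y) * chi r y - c * Theta th (x - y)) Rabs);
        [now apply cont_minus | apply continuous_Rabs].
    + apply ex_RInt_cont; intros y; assert (C2 := Ck y); cont.
    + intros y Hy.
      replace (u y b * Theta th (x - y) * chi r y - c * Theta th (x - y))
        with ((u y b * chi r y - c) * Theta th (x - y)) by ring.
      assert (PT : 0 <= Theta th (x - y)).
      { left. apply Rmult_lt_0_compat; [apply Rinv_0_lt_compat, sqrt_4PI_gt_0, Hth | apply exp_pos]. }
      rewrite Rabs_mult, (Rabs_pos_eq (Theta th (x - y))) by exact PT.
      apply Rmult_le_compat_r; [exact PT|].
      assert (HyX : Rabs y <= X) by (unfold X; apply Rabs_le; lra).
      destruct (chi_bounds r y Hr1) as [Hc [Hc1 _]]; [lra|].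
      assert (Hu : Rabs (u y b - c) <= e).
      { apply Loc; apply Rabs_le; unfold b; lra. }
      assert (Hchi : 1 - chi r y <= e / K).
      { apply Rle_trans with (1 := Hc1). rewrite <- pow2_abs.
        assert (3 * X ^ 2 * K / e <= r ^ 2) by (unfold r0 in Hr; nra).
        apply Rle_div_l; [nra|].
        apply (Rle_div_l (3 * X ^ 2 * K) (r ^ 2) e He) in H.
        apply Rmult_le_reg_r with K; [lra|].
        replace (e / K * r ^ 2 * K) with (r ^ 2 * e) by (field; lra).
        assert (Rabs y ^ 2 <= X ^ 2) by (apply pow_incr; split; [apply Rabs_pos | exact HyX]). nra. }
      replace (u y b * chi r y - c) with ((u y b - c) * chi r y + c * (chi r y - 1)) by ring.
      eapply Rle_trans; [apply Rabs_triang|]. rewrite !Rabs_mult, (Rabs_pos_eq (chi r y)) by lra.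
      rewrite (Rabs_left1 (chi r y - 1)) by lra.
      apply (Rle_div_r (1 - chi r y) e K) in Hchi; [|lra].
      assert (A1 : Rabs (u y b - c) * chi r y <= e * 1)
        by (apply Rmult_le_compat; [apply Rabs_pos | lra | exact Hu | lra]).
      assert (A2 : Rabs c * - (chi r y - 1) <= (1 - chi r y) * K) by (unfold K; nra). lra.
  - rewrite Rint_scal by now apply ex_RInt_cont.
    assert (B := Rmin_l 1 (e / K)). apply Rabs_def2 in Hmass.
    assert (RInt (fun y => Theta th (x - y)) (x - d) (x + d) <= 2) by lra. nra. }
assert (TC : Rabs (c * (RInt (fun y => Theta th (x - y)) (x - d) (x + d) - 1)) <= e).
{ rewrite Rabs_mult. assert (B := Rmin_r 1 (e / K)).
  replace e with (K * (e / K)) by (field; lra).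
  apply Rmult_le_compat; try apply Rabs_pos; [unfold K; lra | lra]. }
unfold cut_pairing. replace (t - b) with th by (unfold b; ring).
rewrite (Rint_Chasles _ (- r) (x - d) r), (Rint_Chasles _ (x - d) (x + d) r) by now apply ex_RInt_cont.
fold c.
apply Rabs_le_between in TR, TL, TM, TC. apply Rabs_le.
unfold e in *. lra.
Qed.

(** * Initial values of the truncated pairing *)

Lemma RInt_param_continuous (f : R -> R -> R) c a b eps : a <= b -> 0 < eps ->
  (forall y, continuous (fun p : R * R => f (snd p) (fst p)) (y, c)) ->
  locally c (fun th => forall y, continuous (f th) y) ->
  exists d, 0 < d /\ forall th, Rabs (th - c) < d -> Rabs (RInt (f th) a b - RInt (f c) a b) <= eps.
Proof.
intros Hab He C2 [d1 C1].
assert (Hk : 0 < eps / (b - a + 1)) by (apply Rdiv_lt_0_compat; lra).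
destruct (uniform_continuity_2d_1d (fun y th => f th y) a b c) with (eps := mkposreal _ Hk) as [d2 H2].
{ intros y _. apply continuity_2d_pt_filterlim. apply (C2 y). }
simpl in H2. assert (P1 := cond_pos d1). assert (P2 := cond_pos d2).
exists (Rmin d1 d2). split; [now apply Rmin_pos|]. intros th Hth.
assert (Hth1 : Rabs (th - c) < d1) by (apply Rlt_le_trans with (1 := Hth), Rmin_l).
assert (Hth2 : Rabs (th - c) < d2) by (apply Rlt_le_trans with (1 := Hth), Rmin_r).
assert (Cth := C1 th Hth1).
assert (Cc : forall y, continuous (f c) y) by (apply C1, ball_center).
rewrite <- Rint_minus by now apply ex_RInt_cont.
apply Rle_trans with ((b - a) * (eps / (b - a + 1))).
- apply (abs_RInt_le_const (fun y => f th y - f c y)); [exact Hab | |].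
  + apply ex_RInt_cont; intros; now apply cont_minus.
  + intros y Hy. left. apply Rabs_def2 in Hth2. apply H2; try lra.
    rewrite Rminus_diag. now rewrite Rabs_R0.
- replace eps with ((b - a + 1) * (eps / (b - a + 1))) at 2 by (field; lra).
  apply Rmult_le_compat_r; lra.
Qed.

Lemma continuous_gker'_2d s x r y c : 0 < s -> 0 < c -> r <> 0 ->
  continuous (fun p : R * R => gker' s x (snd p) r (fst p)) (y, c).
Proof.
intros Hs Hc Hr. unfold gker', hker, dlog.
assert (P := PI_RGT_0). assert (Q := sqrt_4PI_gt_0 c Hc).
assert (C1 : continuous (fun p : R * R => chi r (fst p)) (y, c))
  by (apply (continuous_comp (fun p : R * R => fst p) (chi r)); [apply continuous_fst | now apply continuous_chi]).
assert (C2 : continuous (fun p : R * R => chi1 r (fst p)) (y, c))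
  by (apply (continuous_comp (fun p : R * R => fst p) (chi1 r)); [apply continuous_fst | now apply continuous_chi1]).
cont; simpl; nra.
Qed.

Lemma locally_pos c (P : R -> Prop) : 0 < c -> (forall z, 0 < z -> P z) -> locally c P.
Proof.
intros Hc H. apply (filter_imp (fun z => 0 < z)); [exact H|].
apply (locally_interval _ c 0 p_infty); simpl; trivial; tauto.
Qed.

(** The product rule for [gker tau = omega_quot s tau * gker s]. It frees the contribution of the
    initial distribution from the auxiliary weight [s]. *)
Lemma gker'_omega_quot s tau x th r y : 0 < s -> 0 < tau -> 0 < th ->
  omega_quot' s tau y * gker s x th r y + omega_quot s tau y * gker' s x th r y =
  gker' tau x th r y.
Proof.
intros Hs Htau Ht. unfold gker, gker', omega_quot'.
assert (E : hker tau x th y = omega_quot s tau y * hker s x th y).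
{ rewrite !hkerE, (omega_quotE s tau) by lra.
  assert (P := exp_pos (- y ^ 2 / (4 * tau))). fold (omega tau y) in P.
  assert (Q : 0 < omega_quot s tau y) by apply exp_pos. field. lra. }
rewrite E. unfold dlog. field. lra.
Qed.

(** Split [u(., a)] into [u(., a) - f], whose pairing is at most the Alexiewicz norm times the
    variation of the kernel, and [f], whose pairing is continuous in the time lag. The threshold
    [a0] may depend on [r]. *)
Lemma cut_pairing_initial tau x t u T G sg r eps : 0 < tau -> 0 < t -> 0 < sg -> 1 <= r -> 0 < eps ->
  (forall s y, 0 < s < t -> continuous (fun y => u y s) y) ->
  Acs_prim tau T G ->
  (forall eps, 0 < eps -> exists delta, 0 < delta /\
       forall t, 0 < t < delta ->
         exists Ht, Acs_prim sg (distr_sub (fun_distr (fun y => u y t)) T) Ht /\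
                    alex_norm Ht < eps) ->
  exists a0, 0 < a0 /\ forall a, 0 < a < a0 ->
    Rabs (cut_pairing x t u r a + RInt (fun y => G y * gker' tau x t r y) (- r) r) <= eps.
Proof.
intros Htau Ht Hsg Hr Heps Cu HG HH.
assert (CG : forall y, continuous G y) by apply HG.
(* The variation of the limiting kernel; for lags near [t] the variation is at most [N + 1], hence
   the tolerance [eps / (2 * (N + 1))] below. *)
set (N := RInt (fun y => Rabs (gker' sg x t r y)) (- r) r).
destruct (RInt_param_continuous (fun th y => Rabs (gker' sg x th r y)) t (- r) r 1) as [d1 [Hd1 H1]];
  [lra | lra | | |].
{ intros y. apply (continuous_comp (fun p : R * R => gker' sg x (snd p) r (fst p)) Rabs);
    [apply continuous_gker'_2d; lra | apply continuous_Rabs]. }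
{ apply locally_pos; [exact Ht|]. intros z Hz y.
  apply (continuous_comp (gker' sg x z r) Rabs); [apply continuous_gker'; lra | apply continuous_Rabs]. }
destruct (RInt_param_continuous (fun th y => G y * gker' tau x th r y) t (- r) r (eps / 2)) as [d2 [Hd2 H2]];
  [lra | lra | | |].
{ intros y. apply (cont_mult (fun p : R * R => G (fst p)) (fun p => gker' tau x (snd p) r (fst p)));
    [|apply continuous_gker'_2d; lra].
  apply (continuous_comp (fun p : R * R => fst p) G); [apply continuous_fst | apply CG]. }
{ apply locally_pos; [exact Ht|]. intros z Hz y.
  apply cont_mult; [apply CG | apply continuous_gker'; lra]. }
assert (HN : 0 <= N).
{ apply RInt_ge_0; [lra | | intros; apply Rabs_pos]. apply ex_RInt_cont; intros y.
  apply (continuous_comp (gker' sg x t r) Rabs); [apply continuous_gker'; lra | apply continuous_Rabs]. }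
destruct (HH (eps / (2 * (N + 1)))) as [d3 [Hd3 H3]]; [apply Rdiv_lt_0_compat; lra|].
exists (Rmin (Rmin d1 d2) (Rmin d3 t)). split; [repeat apply Rmin_pos; lra|]. intros a [Ha Ha'].
assert (A : a < d1 /\ a < d2 /\ a < d3 /\ a < t).
{ assert (N1 := Rmin_l (Rmin d1 d2) (Rmin d3 t)). assert (N2 := Rmin_r (Rmin d1 d2) (Rmin d3 t)).
  assert (N3 := Rmin_l d1 d2). assert (N4 := Rmin_r d1 d2).
  assert (N5 := Rmin_l d3 t). assert (N6 := Rmin_r d3 t). lra. }
destruct A as [A1 [A2 [A3 A4]]].
assert (Abs : Rabs (t - a - t) = a).
{ replace (t - a - t) with (- a) by ring. rewrite Rabs_Ropp. apply Rabs_pos_eq; lra. }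
specialize (H1 (t - a)). specialize (H2 (t - a)). rewrite Abs in H1, H2.
specialize (H1 A1). specialize (H2 A2). fold N in H1.
destruct (H3 a (conj Ha A3)) as [H [HHa Hal]].
assert (Cv := fun y => Cu a y (conj Ha A4)).
assert (E : cut_pairing x t u r a = - RInt (fun y => H y * gker' sg x (t - a) r y) (- r) r
  - RInt (fun y => G y * gker' tau x (t - a) r y) (- r) r).
{ unfold cut_pairing.
  rewrite (RInt_ext _ (fun y => u y a * omega sg y * gker sg x (t - a) r y)).
  2: { intros y _. unfold gker. rewrite hkerE.
       assert (P := exp_pos (- y ^ 2 / (4 * sg))). fold (omega sg y) in P. real_eq. field. lra. }
  destruct (gker_ends sg x (t - a) r) as [G1 G2]; [lra|].
  rewrite (Acs_prim_sub_pairing sg tau (fun y => u y a) T G H Hsg Htau Cv HG HHa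
    (gker sg x (t - a) r) (gker' sg x (t - a) r)); trivial.
  - f_equal. apply RInt_ext. intros y _. rewrite gker'_omega_quot by lra. reflexivity.
  - intros; apply is_derive_gker; lra.
  - intros; apply continuous_gker'; lra. }
assert (HB : Rabs (RInt (fun y => H y * gker' sg x (t - a) r y) (- r) r) <= eps / 2).
{ assert (CH : forall y, continuous (fun y => H y * gker' sg x (t - a) r y) y)
    by (intros y; apply cont_mult; [apply HHa | apply continuous_gker'; lra]).
  assert (CA : forall y, continuous (fun y => Rabs (gker' sg x (t - a) r y)) y).
  { intros y. apply (continuous_comp (gker' sg x (t - a) r) Rabs);
      [apply continuous_gker'; lra | apply continuous_Rabs]. }
  set (k := eps / (2 * (N + 1))) in *.
  assert (Hk : 0 < k) by (apply Rdiv_lt_0_compat; lra).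
  apply Rle_trans with (RInt (fun y => k * Rabs (gker' sg x (t - a) r y)) (- r) r).
  - eapply Rle_trans; [apply abs_RInt_le; [lra | now apply ex_RInt_cont]|].
    apply RInt_le; [lra | | |].
    + apply ex_RInt_cont; intros y.
      apply (continuous_comp (fun y => H y * gker' sg x (t - a) r y) Rabs); [apply CH | apply continuous_Rabs].
    + apply ex_RInt_cont; intros y. apply cont_mult; [apply continuous_const | apply CA].
    + intros y _. rewrite Rabs_mult. apply Rmult_le_compat_r; [apply Rabs_pos|].
      left. apply Rle_lt_trans with (2 := Hal), Bc_le_alex_norm, HHa.
  - rewrite Rint_scal by now apply ex_RInt_cont.
    replace (eps / 2) with (k * (N + 1)) by (unfold k; field; lra).
    apply Rmult_le_compat_l; [lra|]. apply Rabs_le_between in H1. lra. }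
rewrite E. apply Rabs_le_between in HB, H2. apply Rabs_le. lra.
Qed.

(** * Removing the cutoff from the convolution *)

Lemma is_lim_prim_decay (f : R -> R) C : (forall y, continuous f y) ->
  (forall y, 0 <= y -> Rabs (f y) <= C / (1 + y) ^ 2) ->
  exists l : R, is_lim (fun y => RInt f 0 y) p_infty l.
Proof.
intros Cf Hf.
assert (HC : 0 <= C).
{ assert (H := Hf 0 (Rle_refl 0)). replace (C / (1 + 0) ^ 2) with C in H by field.
  apply Rle_trans with (2 := H), Rabs_pos. }
assert (Inc : forall a b, 0 <= a <= b -> Rabs (RInt f 0 b - RInt f 0 a) <= C / (1 + a)).
{ intros a b Hab. rewrite (Rint_Chasles f 0 a b) by now apply ex_RInt_cont.
  replace (RInt f 0 a + RInt f a b - RInt f 0 a) with (RInt f a b : R) by lra.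
  apply Rle_trans with (RInt (fun y => C / (1 + y) ^ 2) a b).
  - eapply Rle_trans; [apply abs_RInt_le; [lra | now apply ex_RInt_cont]|].
    apply RInt_le; [lra | | | intros; apply Hf; lra].
    + apply ex_RInt_cont; intros y. apply (continuous_comp f Rabs); [apply Cf | apply continuous_Rabs].
    + apply (ex_RInt_continuous (V := R_CompleteNormedModule)). intros y.
      rewrite Rmin_left, Rmax_right by lra. intros Hy. cont. nra.
  - rewrite (RInt_ftc (fun y => - C / (1 + y))).
    + assert (0 <= C / (1 + b)) by (apply Rdiv_le_0_compat; lra).
      unfold Rdiv in *. lra.
    + intros y. rewrite Rmin_left, Rmax_right by lra. intros Hy.
      auto_derive; [lra | field; lra].
    + intros y. rewrite Rmin_left, Rmax_right by lra. intros Hy. cont. nra. }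
destruct (proj1 (filterlim_locally_cauchy (U := R_CompleteSpace) (F := Rbar_locally p_infty)
  (fun y => RInt f 0 y))) as [l Hl].
- intros eps. set (N := C / eps). assert (He := cond_pos eps).
  assert (HN : 0 <= N) by (apply Rdiv_le_0_compat; lra).
  exists (fun y => N < y). split; [now exists N|].
  assert (W : forall u v, N < u -> u <= v -> Rabs (RInt f 0 v - RInt f 0 u) < eps).
  { intros u v Hu Huv. eapply Rle_lt_trans; [apply Inc; lra|].
    apply Rlt_div_l; [lra|]. apply (Rlt_div_l C u eps He) in Hu. lra. }
  intros u v Hu Hv. change (Rabs (RInt f 0 v - RInt f 0 u) < eps).
  destruct (Rle_lt_dec u v); [now apply W|]. rewrite Rabs_minus_sym. apply W; lra.
- now exists l.
Qed.

(** [Rint_line] lets both ends move independently, so convergence on symmetric intervals alone would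
    not suffice: the primitive needs a limit at each end, on the left by reflection. *)
Lemma Rint_line_decay (f : R -> R) C : (forall y, continuous f y) ->
  (forall y, Rabs (f y) <= C / (1 + Rabs y) ^ 2) ->
  is_lim (fun r => RInt f (- r) r) p_infty (Rint_line f).
Proof.
intros Cf Hf.
destruct (is_lim_prim_decay f C Cf) as [l2 H2].
{ intros y Hy. assert (H := Hf y). now rewrite (Rabs_pos_eq y Hy) in H. }
assert (Cg : forall y, continuous (fun y => f (- y)) y).
{ intros y. apply (continuous_comp Ropp f); [apply cont_opp, continuous_id | apply Cf]. }
destruct (is_lim_prim_decay (fun y => f (- y)) C Cg) as [l1 H1].
{ intros y Hy. assert (H := Hf (- y)). now rewrite Rabs_Ropp, (Rabs_pos_eq y Hy) in H. }
assert (Opp : forall y, RInt (fun y => f (- y)) 0 y = - RInt f 0 (- y)).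
{ intros y. rewrite (RInt_ftc (fun y => - RInt f 0 (- y))).
  - rewrite Ropp_0, RInt_point. change (zero : R) with 0. real_eq. ring.
  - intros z _. eapply is_derive_eq.
    + apply (is_derive_opp (V := R_NormedModule) (fun y => RInt f 0 (- y))).
      apply (is_derive_comp (fun y => RInt f 0 y) Ropp); [now apply is_derive_prim|].
      apply (is_derive_opp (V := R_NormedModule) (fun z => z)), (is_derive_id (K := R_AbsRing)).
    + toR. unfold one; simpl. ring.
  - intros; apply Cg. }
assert (E : Rint_line f = l2 - - l1).
{ apply (Rint_line_of_lim f (fun y => RInt f 0 y)); [intros; now apply is_RInt_prim | | exact H2].
  apply is_lim_spec. intros eps. apply is_lim_spec in H1. destruct (H1 eps) as [N HN].
  exists (- N). intros y Hy. specialize (HN (- y) ltac:(lra)). rewrite Opp, Ropp_involutive in HN.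
  rewrite Rabs_minus_sym. replace (- l1 - RInt f 0 y) with (- RInt f 0 y - l1) by lra.
  exact HN. }
rewrite E. apply (is_lim_ext (fun r => RInt f 0 r - - RInt (fun y => f (- y)) 0 r)).
- intros r. rewrite Opp, Ropp_involutive, (Rint_Chasles f 0 (- r) r) by now apply ex_RInt_cont.
  lra.
- apply (is_lim_minus' _ _ p_infty l2 (- l1)); [exact H2 | now apply (is_lim_opp _ p_infty l1)].
Qed.

(** A sum rather than a difference, because [heat_conv] is minus the integral of [G h']: its
    boundary term dies with [hker] at infinity, as [t < tau]. *)
Lemma heat_conv_cut tau G x t eps : 0 < t < tau -> Bc G -> 0 < eps ->
  exists r0, forall r, r0 <= r ->
    Rabs (RInt (fun y => G y * gker' tau x t r y) (- r) r + heat_conv tau G t x) <= eps.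
Proof.
intros Ht BG Heps. assert (CG : forall y, continuous G y) by apply BG.
destruct (Bc_bounded G BG) as [M HM].
assert (HM0 : 0 <= M) by (apply Rle_trans with (2 := HM 0), Rabs_pos).
destruct (hker_bound tau t t x) as [B [HB HBy]]; [lra | lra |].
assert (Hh : forall y, 0 < hker tau x t y) by (intros; apply hker_gt_0; lra).
assert (HBt : forall y, hker tau x t y <= B / (1 + Rabs y) ^ 3).
{ intros y. assert (P := Rabs_pos y). apply (Rle_div_r _ B ((1 + Rabs y) ^ 3)); [apply Rlt_gt, pow_lt; lra|].
  rewrite Rmult_comm. apply HBy; lra. }
set (k := (Rabs x + 1) / (2 * t) + / (2 * tau)).
assert (Px := Rabs_pos x).
assert (It : 0 < / (2 * t)) by (apply Rinv_0_lt_compat; lra).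
assert (Itau : 0 < / (2 * tau)) by (apply Rinv_0_lt_compat; lra).
assert (Hk : 0 < k) by (unfold k, Rdiv; nra).
assert (Hd : forall y, Rabs (dlog tau x t y) <= k * (1 + Rabs y)).
{ intros y. unfold dlog, k, Rdiv. eapply Rle_trans; [apply Rabs_triang|].
  rewrite !Rabs_mult, (Rabs_pos_eq (/ (2 * t))), (Rabs_pos_eq (/ (2 * tau))) by lra.
  assert (T := Rabs_triang x (- y)). rewrite Rabs_Ropp in T. assert (P := Rabs_pos y).
  fold (x - y) in T.
  assert (Rabs (x - y) * / (2 * t) <= (Rabs x + 1) * (1 + Rabs y) * / (2 * t))
    by (apply Rmult_le_compat_r; nra).
  nra. }
set (f := fun y => G y * (hker tau x t y * dlog tau x t y)).
assert (Cf : forall y, continuous f y).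
{ intros y. assert (C1 := CG y). assert (C2 := continuous_hker tau x t y ltac:(lra) ltac:(lra)).
  assert (C3 := continuous_dlog tau x t y ltac:(lra) ltac:(lra)). unfold f. cont. }
assert (Df : forall y, Rabs (f y) <= M * k * B / (1 + Rabs y) ^ 2).
{ intros y. unfold f. assert (P := Rabs_pos y).
  rewrite !Rabs_mult, (Rabs_pos_eq (hker tau x t y)) by (left; apply Hh).
  replace (M * k * B / (1 + Rabs y) ^ 2)
    with (M * (B / (1 + Rabs y) ^ 3 * (k * (1 + Rabs y)))) by (field; lra).
  apply Rmult_le_compat; [apply Rabs_pos | | apply HM |].
  - apply Rmult_le_pos; [left; apply Hh | apply Rabs_pos].
  - apply Rmult_le_compat; [left; apply Hh | apply Rabs_pos | apply HBt | apply Hd]. }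
assert (HL : is_lim (hker tau x t) p_infty 0).
{ apply (is_lim_le_le_loc (fun _ => 0) (fun y => B * / y)).
  - exists 1. intros y Hy. split; [left; apply Hh|]. eapply Rle_trans; [apply HBt|].
    apply Rmult_le_compat_l; [lra|]. rewrite Rabs_pos_eq by lra.
    apply Rinv_le_contravar; [lra|]. simpl. nra.
  - apply is_lim_const.
  - replace (Finite 0) with (Rbar_mult B 0) by (simpl; now rewrite Rmult_0_r).
    apply is_lim_scal_l.
    apply (is_lim_inv (fun x => x) p_infty p_infty (is_lim_id p_infty)); discriminate. }
assert (E : heat_conv tau G t x = - Rint_line f).
{ unfold heat_conv. cbv zeta.
  replace (fun xi => Theta t (x - xi) / omega tau xi) with (hker tau x t)
    by (apply functional_extensionality; intros; apply hkerE).
  replace (fun xi => G xi * Derive (hker tau x t) xi) with f.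
  - rewrite (is_lim_unique _ _ _ HL). simpl. ring.
  - apply functional_extensionality; intros y. unfold f. f_equal. symmetry.
    apply is_derive_unique, is_derive_hker; lra. }
assert (L := Rint_line_decay f _ Cf Df). apply is_lim_spec in L.
destruct (L (mkposreal (eps / 2) ltac:(lra))) as [N HN]. simpl in HN.
(* [3 * k] bounds [dlog] times [1 - chi], 6 bounds [chi1], and 2 comes from the length [2 * r]; the
   cutoff error is [c / r]. *)
set (c := 2 * (M * (3 * k + 6) * B)).
assert (Hc : 0 <= c) by (unfold c; repeat apply Rmult_le_pos; lra).
assert (Hce : 0 <= c / (eps / 2)) by (apply Rdiv_le_0_compat; lra).
exists (Rmax (N + 1) (1 + c / (eps / 2))). intros r Hr.
assert (Hr1 : N < r) by (assert (X := Rmax_l (N + 1) (1 + c / (eps / 2))); lra).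
assert (Hr2 : 1 + c / (eps / 2) <= r) by (assert (X := Rmax_r (N + 1) (1 + c / (eps / 2))); lra).
specialize (HN r Hr1).
assert (Dd : Rabs (RInt (fun y => G y * gker' tau x t r y) (- r) r - RInt f (- r) r) <= eps / 2).
{ assert (C1 : forall y, continuous (fun y => G y * gker' tau x t r y) y)
    by (intros y; apply cont_mult; [apply CG | apply continuous_gker'; lra]).
  rewrite <- Rint_minus by now apply ex_RInt_cont.
  apply Rle_trans with (2 * r * (M * (3 * k + 6) * B / r ^ 2)).
  - apply RInt_abs_le_const; [lra | intros; now apply cont_minus |]. intros y Hy.
    unfold f, gker'.
    replace (G y * (hker tau x t y * (dlog tau x t y * chi r y + chi1 r y)) -
       G y * (hker tau x t y * dlog tau x t y))
      with (G y * (hker tau x t y * (dlog tau x t y * (chi r y - 1) + chi1 r y))) by ring.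
    destruct (chi_bounds r y) as [B0 [B1 [B2 _]]]; [lra | exact Hy |].
    assert (P := Rabs_pos y). set (m := 1 + Rabs y). assert (Hm : 1 <= m) by (unfold m; lra).
    assert (Ir : 0 < / r ^ 2) by (apply Rinv_0_lt_compat; nra).
    assert (F1 : Rabs (dlog tau x t y * (chi r y - 1)) <= k * m * (3 * m ^ 2 / r ^ 2)).
    { rewrite Rabs_mult. apply Rmult_le_compat; [apply Rabs_pos | apply Rabs_pos | apply Hd |].
      rewrite Rabs_left1 by lra. apply Rle_trans with (3 * y ^ 2 / r ^ 2); [lra|].
      unfold Rdiv. apply Rmult_le_compat_r; [lra|]. rewrite <- pow2_abs. unfold m. nra. }
    assert (F2 : Rabs (chi1 r y) <= 6 * m ^ 3 / r ^ 2).
    { apply Rle_trans with (1 := B2). unfold Rdiv. apply Rmult_le_compat_r; [lra|].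
      assert (Rabs y <= m) by (unfold m; lra). assert (m <= m ^ 3) by (simpl; nra). lra. }
    rewrite !Rabs_mult, (Rabs_pos_eq (hker tau x t y)) by (left; apply Hh).
    replace (M * (3 * k + 6) * B / r ^ 2) with (M * ((3 * k + 6) * B / r ^ 2)) by (field; lra).
    apply Rmult_le_compat; [apply Rabs_pos | | apply HM |].
    { apply Rmult_le_pos; [left; apply Hh | apply Rabs_pos]. }
    apply Rle_trans with (B / m ^ 3 * ((3 * k + 6) * m ^ 3 / r ^ 2)).
    + apply Rmult_le_compat; [left; apply Hh | apply Rabs_pos | apply HBt |].
      eapply Rle_trans; [apply Rabs_triang|].
      replace ((3 * k + 6) * m ^ 3 / r ^ 2)
        with (k * m * (3 * m ^ 2 / r ^ 2) + 6 * m ^ 3 / r ^ 2) by (field; lra). lra.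
    + right. field. lra.
  - replace (2 * r * (M * (3 * k + 6) * B / r ^ 2)) with (c / r) by (unfold c; field; lra).
    apply Rle_div_l; [lra|].
    assert (c / (eps / 2) * (eps / 2) = c) by (field; lra). nra. }
rewrite E. apply Rabs_le_between in Dd. apply Rabs_def2 in HN. apply Rabs_le. lra.
Qed.

(** * Chaining the time intervals *)

Lemma alex_norm_uniform_bound tau u sg b :
  (exists M : R, forall t, 0 < t < tau - sg ->
     exists Gt, Acs_prim sg (fun_distr (fun y => u y t)) Gt /\
                alex_norm Gt * sqrt (tau - sg - t) <= M) ->
  b < tau - sg ->
  exists M, forall s, 0 < s <= b -> exists Gs,
    Acs_prim sg (fun_distr (fun y => u y s)) Gs /\ forall y, Rabs (Gs y) <= M.
Proof.
intros [M HM] Hb. assert (Q := sqrt_lt_R0 (tau - sg - b) ltac:(lra)).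
exists (M / sqrt (tau - sg - b)). intros s Hs.
destruct (HM s) as [Gs [HG Hn]]; [lra|].
exists Gs. split; [exact HG|]. intros y.
assert (Hy := Bc_le_alex_norm Gs y (proj1 HG)). assert (P := Rabs_pos (Gs y)).
apply Rle_div_r; [exact Q|]. apply Rle_trans with (2 := Hn).
apply Rmult_le_compat; [exact P | lra | exact Hy | apply sqrt_le_1_alt; lra].
Qed.

Theorem theorem6p6 (tau : R) (u : R -> R -> R) (T : distr) (G : R -> R) :
  0 < tau ->
  (* regularity: u in C^{2,1}(R x (0,tau)) *)
  (forall x t, 0 < t < tau ->
     ex_derive (fun y => u y t) x /\
     ex_derive (fun y => Derive (fun z => u z t) y) x /\
     ex_derive (fun s => u x s) t /\
     continuous (fun p : R * R => u (fst p) (snd p)) (x, t) /\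
     continuous (fun p : R * R => Derive (fun z => u z (snd p)) (fst p)) (x, t) /\
     continuous (fun p : R * R =>
        Derive (fun y => Derive (fun z => u z (snd p)) y) (fst p)) (x, t) /\
     continuous (fun p : R * R => Derive (fun s => u (fst p) s) (snd p)) (x, t)) ->
  (* heat equation *)
  (forall x t, 0 < t < tau ->
     Derive (fun s => u x s) t - Derive (fun y => Derive (fun z => u z t) y) x = 0) ->
  (* f in A_{c,tau}, with f omega_tau = G' *)
  Acs_prim tau T G ->
  (* u(.,t) in A_{c,sigma} and ||u(.,t)||_sigma sqrt(tau-sigma-t) bounded *)
  (forall sigma, 0 < sigma < tau ->
     exists M : R, forall t, 0 < t < tau - sigma ->
       exists Gt, Acs_prim sigma (fun_distr (fun y => u y t)) Gt /\
                  alex_norm Gt * sqrt (tau - sigma - t) <= M) ->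
  (* ||u(.,t) - f||_sigma -> 0 as t -> 0+ *)
  (forall sigma, 0 < sigma < tau ->
     forall eps, 0 < eps -> exists delta, 0 < delta /\
       forall t, 0 < t < delta ->
         exists Ht, Acs_prim sigma (distr_sub (fun_distr (fun y => u y t)) T) Ht /\
                    alex_norm Ht < eps) ->
  forall x t, 0 < t < tau -> u x t = heat_conv tau G t x.
Proof.
intros Htau Hreg Hheat HG Hbd Hini x t Ht.
assert (Cu2 : forall y s, 0 < s < tau -> continuous (fun p : R * R => u (fst p) (snd p)) (y, s))
  by (intros y s Hs; destruct (Hreg y s Hs) as [_ [_ [_ [H _]]]]; exact H).
assert (Cu : forall s y, 0 < s < t -> continuous (fun y => u y s) y)
  by (intros; apply (continuous_slice u), Cu2; lra).
(* Half of the admissible length: on [[a, b]] with [b - a <= l], a weight exceeding the largest lag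
   [t - a] by [l / 2] still stays below [tau - b] by at least [l / 2]. *)
set (l := (tau - t) / 2). assert (Hl : 0 < l) by (unfold l; lra).
set (A := fun r => - RInt (fun y => G y * gker' tau x t r y) (- r) r).
set (P := fun b => exists K, forall r, 1 <= r -> Rabs (cut_pairing x t u r b - A r) <= K / r).
assert (Base : forall b, 0 < b < t -> b <= l -> P b).
{ intros b Hb Hbl. set (sg := t + l / 2).
  destruct (alex_norm_uniform_bound tau u sg b) as [M HM];
    [apply Hbd; unfold sg, l in *; lra | unfold sg, l in *; lra |].
  destruct (cut_pairing_lipschitz tau x t u Ht Hreg Hheat sg t M b) as [K HK];
    [unfold sg; lra | lra | intros s Hs _; now apply HM |].
  (* For fixed [r] let [a] tend to 0: [a] depends on [r] and [e], but [K] does not. *)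
  exists K. intros r Hr. apply le_epsilon. intros e He.
  destruct (cut_pairing_initial tau x t u T G sg r e) as [a0 [Ha0 Ha]]; trivial;
    [lra | unfold sg; lra | apply Hini; unfold sg, l in *; lra |].
  set (a := Rmin (a0 / 2) b).
  assert (Haa : 0 < a /\ a < a0 /\ a <= b).
  { assert (N1 := Rmin_l (a0 / 2) b). assert (N2 := Rmin_r (a0 / 2) b). fold a in N1, N2.
    assert (0 < a) by (apply Rmin_pos; lra). lra. }
  specialize (Ha a ltac:(lra)). specialize (HK r a Hr ltac:(lra) ltac:(lra)).
  replace (cut_pairing x t u r b - A r)
    with ((cut_pairing x t u r b - cut_pairing x t u r a) + (cut_pairing x t u r a - A r)) by ring.
  eapply Rle_trans; [apply Rabs_triang|]. apply Rplus_le_compat; [exact HK|].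
  unfold A, Rminus. rewrite Ropp_involutive. exact Ha. }
assert (Step : forall a b, 0 < a -> a < b < t -> b - a <= l -> P a -> P b).
{ intros a b Ha Hb Hab [K1 H1]. set (sg := t - a + l / 2).
  destruct (alex_norm_uniform_bound tau u sg b) as [M HM];
    [apply Hbd; unfold sg, l in *; lra | unfold sg, l in *; lra |].
  destruct (cut_pairing_lipschitz tau x t u Ht Hreg Hheat sg (t - a) M b) as [K HK];
    [unfold sg; lra | lra | intros s Hs _; now apply HM |].
  exists (K + K1). intros r Hr. specialize (HK r a Hr ltac:(lra) ltac:(lra)). specialize (H1 r Hr).
  replace (cut_pairing x t u r b - A r)
    with ((cut_pairing x t u r b - cut_pairing x t u r a) + (cut_pairing x t u r a - A r)) by ring.
  eapply Rle_trans; [apply Rabs_triang|]. unfold Rdiv in *. lra. }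
assert (All : forall (n : nat) b, 0 < b < t -> b <= INR n * l -> P b).
{ induction n as [|n IH]; intros b Hb Hn; [simpl in Hn; lra|].
  rewrite S_INR in Hn. destruct (Rle_lt_dec b l) as [Hbl | Hbl]; [now apply Base|].
  apply (Step (b - l)); [lra | lra | lra |]. apply IH; lra. }
(* Three errors of [eps / 4] arise: at the terminal time, along the chain and in the truncated
   convolution. The radius is chosen last. *)
apply cond_eq. intros eps Heps.
(* Near the terminal time the lag is small, so the weight need not exceed [t]; with [l] the norm
   bound holds uniformly up to [t < tau - l]. *)
destruct (alex_norm_uniform_bound tau u l t) as [M HM];
  [apply Hbd; unfold l; lra | unfold l; lra |].
destruct (cut_pairing_terminal x t u l M (eps / 4)) as [b [r0 [Hb Hr0]]];
  [lra | lra | lra | now apply Cu2 | exact Cu | intros; apply HM; lra |].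
destruct (INR_unbounded (b / l)) as [n Hn].
destruct (All n b Hb) as [K HK].
{ left. apply (Rlt_div_l b (INR n) l Hl). exact Hn. }
destruct (heat_conv_cut tau G x t (eps / 4) Ht (proj1 HG)) as [r1 Hr1]; [lra|].
set (r2 := 1 + Rabs K / (eps / 4)).
assert (HK2 : 0 <= Rabs K / (eps / 4)) by (apply Rdiv_le_0_compat; [apply Rabs_pos | lra]).
set (r := Rmax (Rmax r0 r1) r2).
assert (Hr : r0 <= r /\ r1 <= r /\ r2 <= r).
{ assert (N1 := Rmax_l (Rmax r0 r1) r2). assert (N2 := Rmax_r (Rmax r0 r1) r2).
  assert (N3 := Rmax_l r0 r1). assert (N4 := Rmax_r r0 r1). unfold r. lra. }
assert (Hr2 : 1 <= r) by (unfold r2 in Hr; lra).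
specialize (Hr0 r (proj1 Hr)). specialize (Hr1 r (proj1 (proj2 Hr))). specialize (HK r Hr2).
assert (HKr : K / r <= eps / 4).
{ apply Rle_div_l; [lra|]. assert (Q := RRle_abs K).
  assert (Rabs K / (eps / 4) * (eps / 4) = Rabs K) by (field; lra). unfold r2 in Hr. nra. }
unfold A in HK.
apply Rabs_le_between in Hr0, Hr1, HK. apply Rabs_def1; lra.
Qed.
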